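(* Let $G \in \mathscr S$. Then: (i) There is a unique element $\mu \in \mathcal{LN}(G)$ such that $\mathcal{LN}(G)^G \setminus \{0\} = \{\alpha \in \mathcal{LN}(G) \mid \alpha \geq \mu\}$. (ii) $\mu = \infty$ if and only if for each non-trivial locally normal subgroup $K$ of $G$, there are finitely many conjugates $K_1, \dots, K_n$ of $K$ in $G$ such that the product $K_1 \cdots K_n$ is an identity neighbourhood in $G$. (iii) If $\mu = \infty$, then every compact subgroup of $G$ commensurated by $G$ is either finite or open. (iv) If $G$ is abstractly simple, then $\mu = \infty$.
   Context: $\mathscr S$ denotes the class of compactly generated locally compact groups that are totally disconnected, topologically simple, and non-discrete. A locally normal subgroup of $G$ is a compact subgroup whose normaliser in $G$ is open. Two subgroups are commensurable if their intersection has finite index in each of them; a subgroup $K \le G$ is commensurated by $G$ if $gKg^{-1}$ is commensurable with $K$ for all $g \in G$. The structure lattice $\mathcal{LN}(G)$ is the set of commensurability classes $[K]$ of locally normal subgroups $K$ of $G$, with the partial order $\leq$ induced by inclusion of locally normal subgroups ($[K] \leq [L]$ iff $K \cap L$ has finite index in $K$). It is a modular lattice, with a global minimum $0$ (the class of the trivial subgroup) and a global maximum $\infty$ (the class of the compact open subgroups). $G$ acts on $\mathcal{LN}(G)$ by lattice automorphisms induced by conjugation, $g.[K] = [gKg^{-1}]$, and $\mathcal{LN}(G)^G$ denotes the set of fixed points of this action. ''Abstractly simple'' means having no normal subgroups (closed or not) other than $\{e\}$ and $G$. *)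

(* Defs.v *)
From HB Require Import structures.
From mathcomp Require Import all_boot all_order.
From mathcomp Require Import all_classical.
From mathcomp Require Import topology.

Set Implicit Arguments.
Unset Strict Implicit.
Unset Printing Implicit Defensive.

Local Open Scope classical_set_scope.
Local Open Scope quotient_scope.
Local Open Scope group_scope.

HB.mixin Record isTopologicalGroup G & Topological G & Group G := {
  mulg_continuous : continuous (fun x : G * G => x.1 * x.2);
  invg_continuous : continuous (fun x : G => x^-1)
}.

#[short(type="topologicalGroupType")]
HB.structure Definition TopologicalGroup :=
  {G of Topological G & Group G & isTopologicalGroup G}.

Section Subgroups.
Variable G : groupType.
Implicit Types (H K L : set G) (g x y : G).

Definition subgroup H : Prop :=
  [/\ H 1, forall x y, H x -> H y -> H (x * y) & forall x, H x -> H x^-1].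

(* gKg^-1; recall that MathComp's [x ^ y] is [y^-1 * (x * y)]. *)
Definition conjset g K : set G := [set x ^ g^-1 | x in K].

Definition normaliser K : set G := [set g | conjset g K = K].

Definition normal_subgroup H : Prop := subgroup H /\ normaliser H = setT.

Definition lcoset x H : set G := [set x * h | h in H].

(* Meant for [H] a subgroup of the subgroup [K]. *)
Definition finite_index H K : Prop := finite_set [set lcoset x H | x in K].

Definition commensurable K L : Prop :=
  finite_index (K `&` L) K /\ finite_index (K `&` L) L.

Definition commensurated K : Prop := forall g, commensurable (conjset g K) K.

Definition mulset A B : set G := [set x * y | x in A & y in B].

Definition abstractly_simple : Prop :=
  forall N, normal_subgroup N -> N = [set 1] \/ N = setT.

Lemma subgroup1 : subgroup [set 1].
Proof.
by split=> // [x y -> ->|x ->]; rewrite /= ?mulg1 ?invg1.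
Qed.

Lemma subgroupI H K : subgroup H -> subgroup K -> subgroup (H `&` K).
Proof.
move=> [H1 HM HV] [K1 KM KV]; split=> // [x y [? ?] [? ?]|x [? ?]].
  by split; [exact: HM|exact: KM].
by split; [exact: HV|exact: KV].
Qed.

Lemma conjsetE g K x : conjset g K x <-> K (x ^ g).
Proof.
split=> [[y Ky <-]|Kx]; first by rewrite -conjgM mulVg conjg1.
by exists (x ^ g) => //; rewrite -conjgM mulgV conjg1.
Qed.

Lemma conjsetM g h K : conjset (g * h) K = conjset g (conjset h K).
Proof.
by apply/seteqP; split=> x; rewrite !conjsetE conjgM.
Qed.

Lemma conjset1 K : conjset 1 K = K.
Proof. by apply/seteqP; split=> x; rewrite conjsetE conjg1. Qed.

Lemma conjsetI g H K : conjset g (H `&` K) = conjset g H `&` conjset g K.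
Proof.
apply/seteqP; split=> x.
  by move/conjsetE => [? ?]; split; exact/conjsetE.
by move=> [/conjsetE ? /conjsetE ?]; apply/conjsetE.
Qed.

Lemma subgroup_conj g K : subgroup K -> subgroup (conjset g K).
Proof.
move=> [K1 KM KV]; split.
- by apply/conjsetE; rewrite conj1g.
- move=> x y /conjsetE Kx /conjsetE Ky; apply/conjsetE.
  by rewrite conjMg; exact: KM.
- by move=> x /conjsetE Kx; apply/conjsetE; rewrite conjVg; exact: KV.
Qed.

Lemma normaliser_conj g K :
  normaliser (conjset g K) = conjset g (normaliser K).
Proof.
apply/seteqP; split=> x.
  move=> xK; apply/conjsetE; rewrite /normaliser /= conjgE 2!conjsetM.
  by rewrite xK -conjsetM mulVg conjset1.
move=> /conjsetE; rewrite /normaliser /= conjgE 2!conjsetM => e.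
by have /(congr1 (conjset g)) := e; rewrite -conjsetM mulgV conjset1.
Qed.

Lemma lcoset_eq H x y : subgroup H -> lcoset x H = lcoset y H <-> H (y^-1 * x).
Proof.
move=> [H1 HM HV]; split=> [e|Hyx].
  have : lcoset x H x by exists 1; rewrite ?mulg1.
  by rewrite e => -[h Hh <-]; rewrite mulKg.
have Hxy : H (x^-1 * y) by move/HV: Hyx; rewrite invgM invgK.
apply/seteqP; split=> _ [h Hh <-].
  by exists (y^-1 * x * h); [exact: HM|rewrite !mulgA mulgV mul1g].
by exists (x^-1 * y * h); [exact: HM|rewrite !mulgA mulgV mul1g].
Qed.

Lemma finite_indexP H K : subgroup H ->
  finite_index H K <->
  exists s : seq G, forall x, K x -> exists2 g, g \in s & H (g^-1 * x).
Proof.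
move=> sH; split=> [/finite_seqP[A eA]|[s sP]].
  have ex (C : set G) : exists x, (exists2 y, K y & lcoset y H = C) ->
      lcoset x H = C.
    have [[y _ yC]|nC] := pselect (exists2 y, K y & lcoset y H = C).
      by exists y.
    by exists 1.
  pose f C := projT1 (cid (ex C)).
  exists [seq f C | C <- A] => x Kx.
  have xA : lcoset x H \in A.
    suff: [set` A] (lcoset x H) by [].
    by rewrite -eA; exists x.
  exists (f (lcoset x H)); first exact: map_f.
  apply/(lcoset_eq _ _ sH)/esym.
  by rewrite /f; case: cid => /= z; apply; exists x.
apply: (@sub_finite_set _ _ [set lcoset x H | x in [set` s]]); last first.
  exact/finite_image/finite_seq.
move=> _ [x Kx <-]; have [g gs Hgx] := sP x Kx.
by exists g => //; apply/esym/lcoset_eq.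
Qed.

Lemma finite_index_sub H H' K : subgroup H -> subgroup H' -> H `<=` H' ->
  finite_index H K -> finite_index H' K.
Proof.
move=> sH sH' HH' /(finite_indexP _ sH)[s sP]; apply/finite_indexP => //.
by exists s => x /sP[g gs /HH']; exists g.
Qed.

Lemma finite_index_refl K : subgroup K -> finite_index (K `&` K) K.
Proof.
rewrite setIid => sK; apply/finite_indexP => //.
by exists [:: 1] => x Kx; exists 1; rewrite ?mem_head // invg1 mul1g.
Qed.

Lemma finite_index_trans K L M : subgroup K -> subgroup L -> subgroup M ->
  finite_index (K `&` L) K -> finite_index (L `&` M) L ->
  finite_index (K `&` M) K.
Proof.
move=> sK sL sM; have sKL := subgroupI sK sL; have sLM := subgroupI sL sM.
have sKM := subgroupI sK sM.
move=> /(finite_indexP _ sKL)[s sP] /(finite_indexP _ sLM)[t tP].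
(* [r (g, h)] represents the coset of [K `&` M] met by [g (K `&` L)] and
   [g h (L `&` M)] *)
have ex (p : G * G) : exists r, forall x, K x -> (K `&` L) (p.1^-1 * x) ->
    (L `&` M) (p.2^-1 * (p.1^-1 * x)) -> (K `&` M) (r^-1 * x).
  have [[y [Ky [_ Ly] [_ My]]]|no] := pselect (exists y,
      [/\ K y, (K `&` L) (p.1^-1 * y) & (L `&` M) (p.2^-1 * (p.1^-1 * y))]).
    exists y => x Kx _ [_ Mx]; case: sK => _ KM KV; case: sM => _ MM MV.
    split; first by apply: KM => //; exact: KV.
    have := MM _ _ (MV _ My) Mx.
    by rewrite !invgM !invgK !mulgA !mulgK.
  by exists 1 => x Kx ? ?; exfalso; apply: no; exists x.
apply/finite_indexP => //.
pose f p := projT1 (cid (ex p)).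
exists [seq f p | p <- [seq (g, h) | g <- s, h <- t]] => x Kx.
have [g gs KLgx] := sP x Kx; have [h ht LMhgx] := tP _ KLgx.2.
exists (f (g, h)); first by apply/map_f/allpairs_f.
by rewrite /f; case: cid => r /=; apply.
Qed.

Lemma finite_index_conj g K L : subgroup K -> subgroup L ->
  finite_index (K `&` L) K ->
  finite_index (conjset g K `&` conjset g L) (conjset g K).
Proof.
move=> sK sL; have sKL := subgroupI sK sL; rewrite -conjsetI.
move=> /(finite_indexP _ sKL)[s sP].
apply/finite_indexP; first exact: subgroup_conj.
exists [seq x ^ g^-1 | x <- s] => x /conjsetE/sP[h hs Hh].
exists (h ^ g^-1); first exact: map_f.
by apply/conjsetE; rewrite conjMg conjVg -conjgM mulVg conjg1.
Qed.

Lemma commensurable_refl K : subgroup K -> commensurable K K.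
Proof. by move=> sK; split; exact: finite_index_refl. Qed.

Lemma commensurable_sym K L : commensurable K L -> commensurable L K.
Proof. by rewrite /commensurable setIC => -[]. Qed.

Lemma commensurable_trans K L M : subgroup K -> subgroup L -> subgroup M ->
  commensurable K L -> commensurable L M -> commensurable K M.
Proof.
move=> sK sL sM [KL LK] [LM ML]; split.
  exact: (finite_index_trans sK sL sM).
by rewrite setIC; apply: (finite_index_trans sM sL sK); rewrite setIC.
Qed.

End Subgroups.

Section LocallyNormal.
Variable G : topologicalGroupType.
Implicit Types (K L : set G) (g : G).

Definition topologically_simple : Prop :=
  forall N : set G, normal_subgroup N -> closed N -> N = [set 1] \/ N = setT.

Definition compactly_generated : Prop :=
  exists2 C : set G, compact C & smallest (@subgroup G) C = setT.

(* Locally compact groups are Hausdorff by convention. *)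
Definition class_S : Prop :=
  [/\ compactly_generated,
      locally_compact [set: G] /\ hausdorff_space G,
      totally_disconnected [set: G],
      topologically_simple &
      @nbhs G G <> principal_filter].

Definition locally_normal K : Prop :=
  [/\ subgroup K, compact K & open (normaliser K)].

Definition lnsub : Type := set_type [set K : set G | locally_normal K].

HB.instance Definition _ := Choice.on lnsub.

Definition lnsub_set (K : lnsub) : set G := val K.
Local Coercion lnsub_set : lnsub >-> set.

Lemma lnsubP (K : lnsub) : locally_normal K.
Proof. exact: set_valP. Qed.

Definition LNSub K (lnK : locally_normal K) : lnsub :=
  SigSub (mem_set lnK : K \in [set K | locally_normal K]).

Lemma lnsub_subgroup (K : lnsub) : subgroup K.
Proof. by case: (lnsubP K). Qed.

Definition lncomm (K L : lnsub) : bool := `[< commensurable K L >].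

Lemma lncomm_refl : reflexive lncomm.
Proof.
by move=> K; apply/asboolP/commensurable_refl/lnsub_subgroup.
Qed.

Lemma lncomm_sym : symmetric lncomm.
Proof.
by move=> K L; apply/asboolP/asboolP; exact: commensurable_sym.
Qed.

Lemma lncomm_trans : transitive lncomm.
Proof.
move=> L K M /asboolP KL /asboolP LM; apply/asboolP.
by apply: (commensurable_trans _ _ _ KL LM); exact: lnsub_subgroup.
Qed.

Canonical lncomm_equiv := EquivRel lncomm lncomm_refl lncomm_sym lncomm_trans.

Definition LN : Type := {eq_quot lncomm}.

HB.instance Definition _ := Choice.on LN.
HB.instance Definition _ := EqQuotient.on LN.

Definition LNclass (K : lnsub) : LN := \pi_LN K.

Lemma LNclass_eq (K L : lnsub) : LNclass K = LNclass L <-> commensurable K L.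
Proof. by split=> [/eqmodP/asboolP|h]; last exact/eqmodP/asboolP. Qed.

Definition LN_le (a b : LN) : bool :=
  `[< finite_index (lnsub_set (repr a) `&` lnsub_set (repr b))
                   (lnsub_set (repr a)) >].

Lemma repr_comm (K : lnsub) : commensurable (lnsub_set (repr (LNclass K))) K.
Proof. by apply/LNclass_eq; rewrite /LNclass reprK. Qed.

Lemma LN_leE (K L : lnsub) :
  LN_le (LNclass K) (LNclass L) <-> finite_index (lnsub_set K `&` L) K.
Proof.
have [h1 h2] := repr_comm K; have [k1 k2] := repr_comm L.
have sK := lnsub_subgroup K; have sL := lnsub_subgroup L.
have sK' := lnsub_subgroup (repr (LNclass K)).
have sL' := lnsub_subgroup (repr (LNclass L)).
rewrite setIC in h2; rewrite setIC in k2.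
split=> [/asboolP h|h].
  exact: (finite_index_trans sK sL' sL (finite_index_trans sK sK' sL' h2 h) k1).
apply/asboolP.
exact: (finite_index_trans sK' sL sL' (finite_index_trans sK' sK sL h1 h) k2).
Qed.

Lemma LN_le_refl : reflexive LN_le.
Proof. by move=> a; apply/asboolP/finite_index_refl/lnsub_subgroup. Qed.

Lemma LN_le_anti : antisymmetric LN_le.
Proof.
move=> a b /andP[/asboolP ab /asboolP ba].
rewrite -[a]reprK -[b]reprK; apply/LNclass_eq; split=> //.
by rewrite setIC.
Qed.

Lemma LN_le_trans : transitive LN_le.
Proof.
move=> b a c /asboolP ab /asboolP bc; apply/asboolP.
by apply: (finite_index_trans _ _ _ ab bc); exact: lnsub_subgroup.
Qed.

Fact LN_display : Order.disp_t. Proof. exact: Order.Disp tt tt. Qed.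

HB.instance Definition _ := Order.Le_isPOrder.Build LN_display LN
  LN_le_refl LN_le_anti LN_le_trans.

Lemma mull_continuous g : continuous (fun x : G => g * x).
Proof.
move=> x; apply: (@continuous_comp _ _ _ (fun x : G => (g, x))
  (fun p : G * G => p.1 * p.2)); last exact: mulg_continuous.
by apply: cvg_pair => /=; [exact: cvg_cst|exact: cvg_id].
Qed.

Lemma conjg_continuous g : continuous (fun x : G => x ^ g).
Proof.
move=> x; apply: (@continuous_comp _ _ _ (fun x : G => x * g)
  (fun x : G => g^-1 * x)); last exact: mull_continuous.
apply: (@continuous_comp _ _ _ (fun x : G => (x, g))
  (fun p : G * G => p.1 * p.2)); last exact: mulg_continuous.
by apply: cvg_pair => /=; [exact: cvg_id|exact: cvg_cst].
Qed.

Lemma conjset_preimage g K : conjset g K = (fun x => x ^ g) @^-1` K.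
Proof. by apply/seteqP; split=> x /conjsetE. Qed.

Lemma locally_normal_conj g K : locally_normal K -> locally_normal (conjset g K).
Proof.
move=> [sK cK oK]; split; first exact: subgroup_conj.
  apply: continuous_compact => //; apply: continuous_subspaceT.
  exact: conjg_continuous.
rewrite normaliser_conj conjset_preimage.
by apply: open_comp => // x _; exact: conjg_continuous.
Qed.

Definition lnsub_conj g (K : lnsub) : lnsub :=
  LNSub (locally_normal_conj g (lnsubP K)).

Definition LNact g (a : LN) : LN := LNclass (lnsub_conj g (repr a)).

Lemma LNactE g (K : lnsub) : LNact g (LNclass K) = LNclass (lnsub_conj g K).
Proof.
apply/LNclass_eq; have [h1 h2] := repr_comm K; split.
  by apply: finite_index_conj h1; exact: lnsub_subgroup.
by rewrite setIC; apply: finite_index_conj; rewrite 1?setIC //;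
  exact: lnsub_subgroup.
Qed.

Definition LNfixed : set LN := [set a | forall g, LNact g a = a].

Lemma locally_normal1 : locally_normal [set (1 : G)].
Proof.
split; [exact: subgroup1|exact: compact_set1|].
rewrite (_ : normaliser _ = setT); first exact: openT.
apply/seteqP; split=> // g _; apply/seteqP; split=> x.
  by move=> [y -> <-]; rewrite conj1g.
by move=> ->; exists 1; rewrite ?conj1g.
Qed.

Definition LN0 : LN := LNclass (LNSub locally_normal1).

(* The class of the compact open subgroups. By [LN_inftyE] the choice of a
   representative is immaterial, and by van Dantzig's theorem there is one as
   soon as G is locally compact and totally disconnected; the default value
   is only used when there is none. *)
Definition LN_infty : LN :=
  LNclass (xget (LNSub locally_normal1) [set U : lnsub | open (U : set G)]).

Lemma compact_open_finite_index K U : subgroup K -> subgroup U ->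
  compact K -> open U -> finite_index (K `&` U) K.
Proof.
move=> sK sU cK oU; apply/finite_indexP; first exact: subgroupI.
have oc x : open (lcoset x U).
  rewrite (_ : lcoset x U = (fun y => x^-1 * y) @^-1` U).
    by apply: open_comp => // y _; exact: mull_continuous.
  apply/seteqP; split=> [_ [u Uu <-]|y /= Uy]; first by rewrite /= mulKg.
  by exists (x^-1 * y); rewrite ?mulVKg.
pose pG : ptopologicalType := HB.pack (TopologicalGroup.sort G)
  (TopologicalGroup.class G) (isPointed.Build G 1).
have cK' : @cover_compact pG K by rewrite -compact_cover.
case: (cK' G K (fun x => lcoset x U)) => [x _|x Kx|D DK KD]; first exact: oc.
  by exists x => //; exists 1; [case: sU|rewrite mulg1].
exists (finmap.enum_fset D) => x Kx.
have [g /= gD [u Uu gux]] := KD x Kx; exists g => //.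
have Kg : K g by apply/set_mem/DK.
split; last by rewrite -gux mulKg.
by case: sK => _ KM KV; apply: KM => //; exact: KV.
Qed.

Lemma LN_inftyE (U : lnsub) : open (U : set G) -> LN_infty = LNclass U.
Proof.
move=> oU; apply/LNclass_eq; case: xgetP => [V _ oV|/(_ U)/(_ oU)//].
have [[sU cU _] [sV cV _]] := (lnsubP U, lnsubP V).
by split; last rewrite setIC; exact: compact_open_finite_index.
Qed.

Lemma LN0_le (a : LN) : (LN0 <= a)%O.
Proof.
rewrite -[a]reprK; apply/LN_leE; rewrite /lnsub_set /=.
apply: (sub_finite_set (image_subset _ (@subset_refl _ _))).
exact/finite_image/finite_set1.
Qed.

Lemma LN_le_infty (U : lnsub) (a : LN) :
  open (U : set G) -> (a <= LN_infty)%O.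
Proof.
move=> oU; rewrite (LN_inftyE oU) -[a]reprK; apply/LN_leE.
have [[sU _ _] [sK cK _]] := (lnsubP U, lnsubP (repr a)).
exact: compact_open_finite_index.
Qed.

End LocallyNormal.

Arguments LNfixed G : clear implicits.
Arguments LN0 {G}.
Arguments LN_infty {G}.

(* Main.v *)
(* The idea for (i).  Fix a compact open subgroup U and a finite symmetric set D
   such that U and D generate G, and an open normal subgroup W of U with
   d^-1 W d <= U for d in D.  Let F be the set of nontrivial closed normal
   subgroups L of U with d^-1 (L /\ W) d <= L for d in D.  Such an L is
   commensurated by G, and by simplicity it is not contained in W; two
   nontrivial commensurated locally normal subgroups meet nontrivially (else
   their quasi-centralisers would be dense normal subgroups).  By compactness of
   U \ W the intersection M of F is nontrivial, hence the least element of F.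
   It remains to see that every nontrivial commensurated closed normal subgroup
   K of U has finite index in a member E of F.  The elements n of G with
   [x, n] in K for all x close to 1 form a normal subgroup Q containing K, so Q
   is dense and meets dU for each d in D, say in n.  The commutators [x, n] with
   x in W fall into finitely many cosets of K, have finitely many U-conjugates
   modulo K and are torsion modulo K; by Dietzmann's lemma they generate a
   finite extension E of K.  Every class above [K] is fixed because K, hence the
   dense normal closure of K, acts trivially on these classes.

   For (ii), the same commutator argument with an arbitrary locally normal K
   shows that a finite product of small subgroups of conjugates of K is
   commensurated.  Parts (iii) and (iv) combine (i) with the Baire property. *)
Require Import Defs.
From mathcomp Require Import all_boot all_order.
From mathcomp Require Import all_classical.
From mathcomp Require Import topology.

Set Implicit Arguments.
Unset Strict Implicit.
Unset Printing Implicit Defensive.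

Local Open Scope classical_set_scope.
Local Open Scope group_scope.

Lemma conjg_conj (G : groupType) (x n g : G) : x ^ (n ^ g) = ((x ^ g^-1) ^ n) ^ g.
Proof. by rewrite -!conjgM [n ^ g]conjgE mulgA. Qed.

(** * Finite unions of cosets *)

Section Covered.
Variable G : groupType.
Implicit Types (A B H K L M : set G) (g x y : G).

(** A form of finite index in which neither set need contain the other, so that it passes to subsets
    and composes without taking intersections. *)
Definition covered A M : Prop :=
  exists s : seq G, forall x, A x -> exists2 g, g \in s & M (g^-1 * x).

Definition normalises A K : Prop := forall u x, A u -> K x -> K (x ^ u).

Lemma coveredS A B M : A `<=` B -> covered B M -> covered A M.
Proof. by move=> AB [s sP]; exists s => x /AB/sP. Qed.

Lemma coveredSr A M M' : M `<=` M' -> covered A M -> covered A M'.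
Proof. by move=> MM [s sP]; exists s => x /sP[g gs /MM]; exists g. Qed.

Lemma covered_refl M : covered M M.
Proof.
by exists [:: 1] => x Mx; exists 1; rewrite ?mem_head // invg1 mul1g.
Qed.

Lemma covered_trans A M M' : covered A M -> covered M M' -> covered A M'.
Proof.
move=> [s sP] [t tP]; exists [seq x * y | x <- s, y <- t] => x /sP[g gs].
move=> /tP[h ht Mx]; exists (g * h); last by rewrite invgM -mulgA.
by apply/allpairsP; exists (g, h).
Qed.

Lemma covered_conj g A M : covered A M -> covered (conjset g A) (conjset g M).
Proof.
move=> [s sP]; exists [seq x ^ g^-1 | x <- s] => x /conjsetE/sP[h hs Mh].
exists (h ^ g^-1); first exact: map_f.
by apply/conjsetE; rewrite conjMg conjVg conjgKV.
Qed.

Lemma covered_lcoset g A M : covered A M -> covered (lcoset g A) M.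
Proof.
move=> [s sP]; exists [seq g * x | x <- s] => _ [x /sP[h hs Mx] <-].
by exists (g * h); [exact: map_f|rewrite invgM !mulgA mulgVK].
Qed.

(** A coset that meets [A] is represented by any of its points in [A]; the cosets that miss [A] are
    filtered out of the list. *)
Lemma covered_rep A M : subgroup M -> covered A M ->
  exists s : seq G, (forall g, g \in s -> A g) /\
    forall x, A x -> exists2 g, g \in s & M (g^-1 * x).
Proof.
move=> [M1 MM MV] [s sP].
have ex g : exists y, (exists2 z, A z & M (g^-1 * z)) ->
    A y /\ M (g^-1 * y).
  have [[z Az Mz]|n] := pselect (exists2 z, A z & M (g^-1 * z)).
    by exists z.
  by exists 1.
have [f fP] := choice ex.
exists [seq f g | g <- s & `[< exists2 z, A z & M (g^-1 * z) >]].
split=> [_ /mapP[g + ->]|x Ax].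
  by rewrite mem_filter => /andP[/asboolP/fP[]].
have [g gs Mg] := sP x Ax; have eg : exists2 z, A z & M (g^-1 * z) by exists x.
exists (f g); first by apply/map_f; rewrite mem_filter gs andbT; apply/asboolP.
have [_ Mf] := fP g eg; have := MM _ _ (MV _ Mf) Mg.
by rewrite invgM invgK mulgA mulgK.
Qed.

Lemma covered_setI K M : subgroup K -> subgroup M ->
  covered K M -> covered K (K `&` M).
Proof.
move=> [K1 KM KV] sM /(covered_rep sM)[s [sK sP]]; exists s => x Kx.
have [g gs Mg] := sP x Kx; exists g => //; split=> //.
by apply: KM => //; apply/KV/sK.
Qed.

Lemma covered_setI2 K M M' : subgroup K -> subgroup M -> subgroup M' ->
  covered K M -> covered K M' -> covered K (M `&` M').
Proof.
move=> sK sM sM' KM KM'; have cKM := covered_setI sK sM KM.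
apply: (covered_trans cKM).
have : covered (K `&` M) (K `&` M `&` M').
  apply: covered_setI => //; first exact: subgroupI.
  by apply: coveredS KM' => x [].
by apply: coveredSr => x [[]].
Qed.

Lemma finite_index_covered K M : subgroup K -> subgroup M ->
  finite_index (K `&` M) K <-> covered K M.
Proof.
move=> sK sM; split=> [/(finite_indexP _ (subgroupI sK sM))|/covered_setI].
  by move=> c; apply: (@coveredSr _ (K `&` M)) => // x [].
by move=> /(_ sK sM) c; apply/finite_indexP => //; exact: subgroupI.
Qed.

Lemma commensurableE K M : subgroup K -> subgroup M ->
  commensurable K M <-> covered K M /\ covered M K.
Proof.
move=> sK sM; rewrite /commensurable finite_index_covered //.
by rewrite setIC finite_index_covered.
Qed.

Lemma covered1_finite K : covered K [set 1] -> finite_set K.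
Proof.
move=> [s sP]; apply: (@sub_finite_set _ _ [set` s]); last exact: finite_seq.
by move=> x /sP[g gs /= e]; rewrite (_ : x = g) // -[g]mulg1 -e mulVKg.
Qed.

Lemma finite_covered K M : subgroup M -> finite_set K -> covered K M.
Proof.
move=> [M1 _ _] /finite_seqP[s ->]; exists s => x xs; exists x => //.
by rewrite mulVg.
Qed.

Lemma normalises_normaliser U K : subgroup U ->
  normalises U K <-> U `<=` normaliser K.
Proof.
move=> [U1 UM UV]; split=> [n u Uu|UN u x Uu Kx].
  apply/seteqP; split=> x.
    by move=> /conjsetE Kx; rewrite -(conjgK u x); apply: n => //; exact: UV.
  by move=> Kx; apply/conjsetE; exact: n.
by apply/conjsetE; rewrite UN.
Qed.

Lemma normalises_refl U : subgroup U -> normalises U U.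
Proof.
move=> [_ UM UV] u x Uu Ux; rewrite conjgE; apply: (UM); first exact: UV.
exact: UM.
Qed.

Lemma subgroup_normaliser K : subgroup (normaliser K).
Proof.
split=> [|x y|x]; rewrite /normaliser /= ?conjset1 //.
  by rewrite conjsetM => + -> => ->.
by move=> e; rewrite -{1}e -conjsetM mulVg conjset1.
Qed.

Lemma conj_normaliserE K g x : normaliser K g -> K (x ^ g) <-> K x.
Proof. by move=> e; rewrite -conjsetE e. Qed.

Lemma subgroupX K x n : subgroup K -> K x -> K (x ^+ n).
Proof.
by move=> [K1 KM _] Kx; elim: n => // n IHn; rewrite expgS; exact: KM.
Qed.

Lemma subgroup_bigcap (I : Type) (D : set I) (F : I -> set G) :
  (forall i, D i -> subgroup (F i)) -> subgroup (\bigcap_(i in D) F i).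
Proof.
move=> sF; split=> [i Di|x y Hx Hy i Di|x Hx i Di]; have [F1 FM FV] := sF _ Di.
- by [].
- by apply: FM; [exact: Hx|exact: Hy].
- by apply: FV; exact: Hx.
Qed.

Definition commensurator L : set G := [set g | commensurable (conjset g L) L].

Lemma subgroup_commensurator L : subgroup L -> subgroup (commensurator L).
Proof.
move=> sL; have sc g := subgroup_conj g sL.
have E g : commensurator L g <-> covered (conjset g L) L /\ covered L (conjset g L).
  exact: commensurableE.
split=> [|x y /E[xl lx] /E[yl ly]|x /E[xl lx]]; apply/E.
- by rewrite conjset1; split; exact: covered_refl.
- rewrite conjsetM; split.
    by apply: covered_trans xl; exact: covered_conj.
  by apply: (covered_trans lx); exact: covered_conj.
- split; first by have := covered_conj x^-1 lx; rewrite -conjsetM mulVg conjset1.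
  by have := covered_conj x^-1 xl; rewrite -conjsetM mulVg conjset1.
Qed.

Lemma normaliser_commensurator L : subgroup L -> normaliser L `<=` commensurator L.
Proof. by move=> sL g e; rewrite /commensurator /= e; exact: commensurable_refl. Qed.

End Covered.

(** The traces of the [F i] on [K] generate a proper filter, and a cluster point of it in [K] lies
    in every closed [F i]. *)
Lemma compact_directed (T : topologicalType) (K : set T) (I : Type)
    (D : set I) (F : I -> set T) :
  compact K -> D !=set0 -> (forall i, D i -> closed (F i)) ->
  (forall i j, D i -> D j -> exists2 k, D k & F k `<=` F i `&` F j) ->
  (forall i, D i -> K `&` F i !=set0) ->
  exists2 x, K x & forall i, D i -> F i x.
Proof.
move=> cK [i0 Di0] cF dF nF.
have FF : ProperFilter (filter_from D (fun i => K `&` F i)).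
  apply: filter_from_proper => //; apply: filter_from_filter; first by exists i0.
  move=> i j Di Dj; have [k Dk kij] := dF i j Di Dj.
  by exists k => // x [Kx /kij[]].
have [|x [Kx cx]] := cK _ FF; first by exists i0 => // x [].
exists x => // i Di; apply: (cF i Di) => B nB.
have [|y [[_ Fy] By]] := cx (K `&` F i) B _ nB; first by exists i.
by exists y.
Qed.

(** * Totally disconnected locally compact groups *)

Section TopologicalGroup.
Variable G : topologicalGroupType.
Implicit Types (A B H K L M U V : set G) (g x y : G).

Lemma nbhs_lmul g x B : nbhs (g * x) B -> nbhs x [set y | B (g * y)].
Proof. exact: mull_continuous. Qed.

Lemma nbhs_conj g x B : nbhs (x ^ g) B -> nbhs x [set y | B (y ^ g)].
Proof. exact: conjg_continuous. Qed.

Lemma nbhs1_conj g B : nbhs (1 : G) B -> nbhs (1 : G) [set y | B (y ^ g)].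
Proof. by move=> nB; apply: nbhs_conj; rewrite conj1g. Qed.

Lemma nbhs_inv x B : nbhs x^-1 B -> nbhs x [set y | B y^-1].
Proof. exact: invg_continuous. Qed.

Lemma nbhs_mul x y B : nbhs (x * y) B ->
  exists A A', [/\ nbhs x A, nbhs y A' & forall a b, A a -> A' b -> B (a * b)].
Proof.
move=> nB; have [[A A'] [nA nA'] AB] := @mulg_continuous G (x, y) _ nB.
by exists A, A'; split => // a b Aa A'b; exact: (AB (a, b)).
Qed.

Lemma nbhs_commg g B : nbhs (1 : G) B -> nbhs (1 : G) [set x | B (x^-1 * x ^ g)].
Proof.
rewrite -[X in nbhs X B]mulg1 => /nbhs_mul[A [A' [nA nA' AB]]].
have nAV : nbhs (1 : G) [set y | A y^-1] by apply: nbhs_inv; rewrite invg1.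
apply: filterS (filterI nAV (nbhs1_conj g nA')) => x [Ax A'x].
exact: AB.
Qed.

Lemma nbhs_seq (s : seq G) (P : G -> set G) x :
  (forall g, g \in s -> nbhs x (P g)) -> nbhs x [set y | forall g, g \in s -> P g y].
Proof.
elim: s => [|g s IHs] nP; first exact: filterS filterT.
have nPs : nbhs x [set y | forall h, h \in s -> P h y].
  by apply: IHs => h hs; apply: nP; rewrite inE hs orbT.
apply: filterS (filterI (nP g (mem_head _ _)) nPs) => y [Pgy Py] h.
by rewrite inE => /predU1P[->//|/Py].
Qed.

Lemma nbhs_subgroup_open H : subgroup H -> nbhs (1 : G) H -> open H.
Proof.
move=> [H1 HM HV] nH; rewrite openE => x Hx.
have : nbhs x [set y | H (x^-1 * y)] by apply: nbhs_lmul; rewrite mulVg.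
by apply: filterS => y /(HM _ _ Hx); rewrite mulVKg.
Qed.

Lemma open_nbhs1 H : subgroup H -> open H -> nbhs (1 : G) H.
Proof. by move=> [H1 _ _] oH; apply: open_nbhs_nbhs. Qed.

Lemma open_subgroupS H K : subgroup H -> subgroup K -> open H -> H `<=` K -> open K.
Proof.
by move=> sH sK oH HK; apply: nbhs_subgroup_open => //; apply: filterS (open_nbhs1 sH oH).
Qed.

Lemma lcosetE g M x : lcoset g M x <-> M (g^-1 * x).
Proof.
by split=> [[h Mh <-]|Mx]; [rewrite mulKg|exists (g^-1 * x); rewrite ?mulVKg].
Qed.

Lemma lcoset_preimage g M : lcoset g M = (fun x => g^-1 * x) @^-1` M.
Proof. by apply/seteqP; split=> x /lcosetE. Qed.

Lemma open_lcoset g M : open M -> open (lcoset g M).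
Proof.
move=> oM; rewrite lcoset_preimage; apply: open_comp => // y _.
exact: mull_continuous.
Qed.

Lemma closed_lcoset g M : closed M -> closed (lcoset g M).
Proof.
move=> cM; rewrite lcoset_preimage; apply: preimage_closed => // y _.
exact: mull_continuous.
Qed.

Lemma closed_conjset g M : closed M -> closed (conjset g M).
Proof.
move=> cM; rewrite conjset_preimage; apply: preimage_closed => // y _.
exact: conjg_continuous.
Qed.

Lemma compact_conjset g M : compact M -> compact (conjset g M).
Proof.
move=> cM; apply: continuous_compact => //; apply: continuous_subspaceT.
exact: conjg_continuous.
Qed.

Lemma open_conjset g M : open M -> open (conjset g M).
Proof.
move=> oM; rewrite conjset_preimage; apply: open_comp => // y _.
exact: conjg_continuous.
Qed.

Lemma compact_mulset A B : compact A -> compact B -> compact (mulset A B).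
Proof.
move=> cA cB; rewrite (_ : mulset A B = (fun p : G * G => p.1 * p.2) @` (A `*` B)).
  apply: continuous_compact; last exact: compact_setX.
  by apply: continuous_subspaceT; exact: mulg_continuous.
apply/seteqP; split=> [_ [a Aa [b Bb <-]]|_ [[a b] [Aa Bb] <-]].
  by exists (a, b).
by exists a => //; exists b.
Qed.

Lemma open_subgroup_closed H : subgroup H -> open H -> closed H.
Proof.
move=> [H1 HM HV] oH; rewrite -openC openE => x nHx.
have : nbhs x [set y | H (x^-1 * y)].
  by apply: nbhs_lmul; rewrite mulVg; apply: open_nbhs_nbhs.
apply: filterS => y Hy Hy'; apply: nHx; have := HM _ _ Hy' (HV _ Hy).
by rewrite invgM invgK mulVKg.
Qed.

(** Otherwise the complements of finite unions of cosets of [V] form a directed family of closed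
    sets meeting [K], and a common point [x] would avoid its own coset. *)
Lemma compact_covered K V : compact K -> subgroup V -> open V -> covered K V.
Proof.
move=> cK sV oV; apply: contrapT => nc.
pose F (s : seq G) := [set x | forall g, g \in s -> ~ V (g^-1 * x)].
have [|s _|s t _ _|s _|x Kx Fx] := @compact_directed _ K (seq G) setT F cK.
- by exists [::].
- rewrite (_ : F s = \bigcap_(g in [set` s]) ~` lcoset g V).
    by apply: closed_bigI => g _; rewrite closedC; exact: open_lcoset.
  by apply/seteqP; split=> x Fx g /Fx nV; [move/lcosetE|move=> Vx; apply/nV/lcosetE].
- exists (s ++ t) => // x Fx.
  by split=> g gs; apply: Fx; rewrite mem_cat gs ?orbT.
- apply: contrapT => n; apply: nc; exists s => x Kx; apply: contrapT => nx.
  by apply: n; exists x; split=> // g gs Vx; apply: nx; exists g.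
- apply: (Fx [:: x] I x); first exact: mem_head.
  by rewrite mulVg; case: sV.
Qed.

(* A finite union of nontrivial cosets of [H] misses a neighbourhood of 1. *)
Lemma closed_covered_nbhs H K : subgroup K -> subgroup H -> closed H ->
  covered K H -> exists2 V, nbhs (1 : G) V & K `&` V `<=` H.
Proof.
move=> [K1 KM KV] [H1 HM HV] cH [s sP].
exists [set y | forall g, g \in s -> ~ H g^-1 -> ~ H (g^-1 * y)].
  apply: nbhs_seq => g _; have [Hg|nHg] := pselect (H g^-1).
    by apply: filterS filterT.
  apply: filterS (_ : nbhs _ (~` lcoset g H)).
    by move=> y nHy _ Hy; apply/nHy/lcosetE.
  apply: open_nbhs_nbhs; split; first exact/closed_openC/closed_lcoset.
  by move=> /lcosetE; rewrite mulg1.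
move=> x [Kx Vx]; have [g gs Hgx] := sP x Kx.
have [Hg|nHg] := pselect (H g^-1); last by have := Vx g gs nHg.
by have := HM _ _ (HV _ Hg) Hgx; rewrite invgK mulVKg.
Qed.

End TopologicalGroup.

(** In a compact neighbourhood [A] of [x] the quasi-component [Q] of [x] is connected, hence reduced
    to [x]; compactness then puts a relatively clopen set inside [N] and the interior of [A], where
    it is open in the whole space. *)
Lemma totally_disconnected_clopen (T : topologicalType) (x : T) (N : set T) :
  hausdorff_space T -> totally_disconnected [set: T] ->
  locally_compact [set: T] -> nbhs x N ->
  exists B, [/\ compact B, open B, B x & B `<=` N].
Proof.
move=> hT tdT lcT nN.
have [K] := @lcT x I; rewrite withinET => nK [cK _].
have [V nV VK] := compact_regular hT cK nK (nbhs_interior nK).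
pose A := closure V; have clA : closed A by exact: closed_closure.
have cA : compact A.
  by apply: subclosed_compact cK _ => // y /VK; exact: interior_subset.
have nA : nbhs x A by apply: filterS nV; exact: subset_closure.
have Ax : A x by exact: nbhs_singleton.
(* The clopen neighbourhoods of [x] in the subspace [A]. *)
pose D := [set B : set T | [/\ B `<=` A, B x, closed B & closed (A `\` B)]].
have DA : D A by split=> //; rewrite setDv; exact: closed0.
have DI B C : D B -> D C -> D (B `&` C).
  move=> [BA Bx cB cB'] [CA Cx cC cC']; split=> //.
  - by move=> y [/BA].
  - exact: closedI.
  - by rewrite setDIr; exact: closedU.
(* Compactness of [A]: a closed set disjoint from the whole intersection [Q] is already disjoint
   from one member of [D]. *)
have sep (C : set T) : closed C -> ~ C x -> (forall y, (\bigcap_(B in D) B) y -> ~ C y) ->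
    exists2 B, D B & forall y, B y -> ~ C y.
  move=> cC nCx QC; apply: contrapT => n.
  have [|B [_ _ cB _]|B B' DB DB'|B DB|y Ay Hy] :=
    @compact_directed _ A (set T) D (fun B => B `&` C) cA.
  - by exists A.
  - exact: closedI.
  - by exists (B `&` B'); [exact: DI|move=> y [[]]].
  - apply: contrapT => e; apply: n; exists B => // y By Cy; apply: e.
    by exists y; case: DB => BA *; split=> //; exact: BA.
  - by apply: (QC y) => [B /Hy[]|]; have [] := Hy A DA.
pose Q := \bigcap_(B in D) B.
have cQ : closed Q by apply: closed_bigI => B [].
have Qx : Q x by move=> B [].
have QA : Q `<=` A by move=> y; apply.
have conQ : connected Q.
  (* It is enough to treat relatively clopen parts of [Q] that contain [x]: if a nonempty one does
     not, its complement in [Q] does. *)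
  suff key (B : set T) : B x -> (exists2 C, open C & B = Q `&` C) ->
      (exists2 C, closed C & B = Q `&` C) -> B = Q.
    move=> B [z Bz] [C oC BC] [C' cC' BC'].
    have [Bx|nBx] := pselect (B x).
      by apply: key => //; [exists C|exists C'].
    have : Q `\` B = Q.
      apply: key => //.
      - exists (~` C'); first exact: closed_openC.
        by rewrite BC' setDIr setDv set0U setDE.
      - exists (~` C); first exact: open_closedC.
        by rewrite BC setDIr setDv set0U setDE.
    move=> e; exfalso; have : Q z by move: Bz; rewrite BC => -[].
    by rewrite -e => -[].
  move=> Bx [C oC BC] [C' cC' BC'].
  have cB : closed B by rewrite BC'; exact: closedI.
  have cQB : closed (Q `\` B).
    by rewrite BC setDIr setDv set0U setDE; apply: closedI => //; exact: open_closedC.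
  have BQ : B `<=` Q by rewrite BC => y [].
  have [||M /set_nbhsP[O1 [oO BO OM]] clM] :=
    @compact_normal_local _ K hT cK B _ cB (~` (Q `\` B)).
  - by move=> y /BQ/QA/VK.
  - apply/set_nbhsP; exists (~` (Q `\` B)); split=> //; first exact: closed_openC.
    by move=> y By [].
  have O1M y : O1 y -> closure M y by move=> /OM; exact: subset_closure.
  (* [Q] lies in [O1] or outside [closure M], so some [B'] in [D] does as well. On [B'] the closed
     set [closure M] and the open set [O1] then agree, which cuts out a member of [D] missing the
     rest of [Q]. *)
  have [|||B' DB' B'O] := sep (A `\` (O1 `|` ~` closure M)).
  - rewrite setDE; apply: closedI => //; apply: open_closedC.
    by apply: openU => //; apply: closed_openC; exact: closed_closure.
  - by move=> [_]; apply; left; exact: BO.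
  - move=> y Qy [_]; apply; have [By|nBy] := pselect (B y).
      by left; exact: BO.
    by right=> My; apply: (clM _ My).
  have E : B' `&` closure M = B' `&` O1.
    apply/seteqP; split=> y [B'y]; last by move=> /O1M.
    move=> My; split=> //; apply: contrapT => nO; apply: (B'O y B'y).
    by split; [case: DB' => + *; apply|case].
  have DB : D (B' `&` closure M).
    case: DB' => B'A B'x cB' cAB'; split.
    - by move=> y [/B'A].
    - by split=> //; exact/O1M/BO.
    - by apply: closedI => //; exact: closed_closure.
    - by rewrite E setDIr; apply: closedU => //; rewrite setDE;
        apply: closedI => //; exact: open_closedC.
  apply/seteqP; split=> // y Qy; apply: contrapT => nBy.
  by have [_ My] := Qy _ DB; apply: (clM _ My).
have Q1 : Q = [set x].
  apply/seteqP; split=> [y Qy|y ->//].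
  rewrite -(tdT x I); exists Q => //; split=> //.
have nAN : nbhs x (A° `&` N°) by apply: filterI; exact: nbhs_interior.
have [||y|B [BA Bx cB cB'] Bn] := sep (A `\` (A° `&` N°)).
- rewrite setDE; apply: closedI => //; apply: open_closedC.
  by apply: openI; exact: open_interior.
- by move=> [_]; apply; exact: nbhs_singleton nAN.
- by rewrite -/Q Q1 => -> [_]; apply; exact: nbhs_singleton nAN.
have BI : B `<=` A° `&` N°.
  move=> y By; apply: contrapT => n; apply: (Bn y By); split=> //; exact: BA.
exists B; split=> //.
- exact: subclosed_compact cA BA.
- rewrite (_ : B = A° `&` ~` (A `\` B)).
    by apply: openI; [exact: open_interior|exact: closed_openC].
  apply/seteqP; split=> y; first by move=> By; split; [case: (BI y By)|case].
  move=> [Iy nAB]; apply: contrapT => nBy; apply: nAB; split=> //.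
  exact: interior_subset Iy.
- by move=> y /BI[_ /interior_subset].
Qed.

(** * Van Dantzig's theorem: compact open subgroups form a base at 1 *)

Section CompactOpenSubgroups.
Variable G : topologicalGroupType.
Implicit Types (A B H K L M U V : set G) (g x y : G).

Definition cosubgroup V : Prop := [/\ subgroup V, compact V & open V].

(** Tube argument: continuity of the product at [(a, 1)] gives a neighbourhood of 1 that works near
    [a], and compactness makes it uniform in [a]. *)
Lemma nbhs1_stabiliser A : compact A -> open A ->
  nbhs (1 : G) [set h | forall a, A a -> A (a * h)].
Proof.
move=> /compact_near_coveringP cA oA.
apply: (cA G (nbhs (1 : G)) (fun h a => A (a * h)) _) => a Aa.
have [|V [V' [nV nV' VV]]] := @nbhs_mul G a 1 A.
  by rewrite mulg1; exact: open_nbhs_nbhs.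
by exists (V, V') => // -[b h] [/= Vb V'h]; exact: VV.
Qed.

(** The right translations preserving a compact open neighbourhood [A] of 1 form a subgroup [H]; it
    lies in [A] because [A] contains 1, and it is open by [nbhs1_stabiliser]. *)
Lemma van_dantzig B : hausdorff_space G -> totally_disconnected [set: G] ->
  locally_compact [set: G] -> nbhs (1 : G) B ->
  exists2 V, cosubgroup V & V `<=` B.
Proof.
move=> hG tdG lcG nB.
have [A [cA oA A1 AB]] := totally_disconnected_clopen hG tdG lcG nB.
pose H := [set h : G | forall a, A a -> A (a * h) /\ A (a * h^-1)].
have sH : subgroup H.
  split=> [a Aa|x y Hx Hy a Aa|x Hx a Aa]; first by rewrite invg1 mulg1.
    rewrite invgM !mulgA; split.
      by have [Ax _] := Hx a Aa; case: (Hy _ Ax).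
    by have [_ Ay] := Hy a Aa; case: (Hx _ Ay).
  by rewrite invgK; case: (Hx a Aa).
have HA : H `<=` A by move=> x /(_ 1 A1)[]; rewrite mul1g.
have nS := nbhs1_stabiliser cA oA.
have oH : open H.
  apply: nbhs_subgroup_open => //.
  have nS' : nbhs (1 : G) [set h | forall a, A a -> A (a * h^-1)].
    by apply: (@nbhs_inv G 1 [set h | forall a, A a -> A (a * h)]); rewrite invg1.
  by apply: filterS (filterI nS nS') => h [h1 h2] a Aa; split; [exact: h1|exact: h2].
exists H; last by move=> x /HA/AB.
by split=> //; apply: subclosed_compact cA HA; exact: open_subgroup_closed.
Qed.

End CompactOpenSubgroups.

(** * Closures, cores, and commensuration read near the identity *)

Section Closure.
Variable G : topologicalGroupType.
Implicit Types (A B H K L M N U V : set G) (g x y : G).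

Lemma normal_subgroupP N :
  normal_subgroup N <-> subgroup N /\ normalises setT N.
Proof.
have sT : subgroup [set: G] by [].
split=> [[sN nN]|[sN /(normalises_normaliser _ sT) nN]]; split=> //.
  by apply/normalises_normaliser => //; rewrite nN.
by apply/seteqP; split.
Qed.

Lemma subgroup_closure H : subgroup H -> subgroup (closure H).
Proof.
move=> [H1 HM HV]; split=> [|x y cx cy B|x cx B].
- exact: subset_closure.
- move=> /nbhs_mul[A [A' [/cx[n [Hn An]] /cy[m [Hm A'm]] AB]]].
  by exists (n * m); split; [exact: HM|exact: AB].
- move=> /nbhs_inv/cx[n [Hn Bn]]; exists n^-1; split => //.
  exact: HV.
Qed.

Lemma normal_subgroup_closure N : normal_subgroup N -> normal_subgroup (closure N).
Proof.
move=> /normal_subgroupP[sN nN]; apply/normal_subgroupP; split.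
  exact: subgroup_closure.
move=> g x _ cx B /nbhs_conj/cx[n [Nn Bn]].
by exists (n ^ g); split=> //; exact: nN.
Qed.

(** The intersection of the conjugates of [K] under [U]. *)
Definition core U K : set G := [set x | forall u, U u -> K (x ^ u)].

Lemma subgroup_core U K : subgroup K -> subgroup (core U K).
Proof.
move=> [K1 KM KV]; split=> [u _|x y Kx Ky u Uu|x Kx u Uu].
- by rewrite conj1g.
- by rewrite conjMg; apply: KM; [exact: Kx|exact: Ky].
- by rewrite conjVg; apply/KV/Kx.
Qed.

Lemma core_sub U K : subgroup U -> core U K `<=` K.
Proof. by move=> [U1 _ _] x /(_ 1 U1); rewrite conjg1. Qed.

Lemma closed_core U K : closed K -> closed (core U K).
Proof.
move=> cK; rewrite (_ : core U K = \bigcap_(u in U) conjset u K).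
  by apply: closed_bigI => u _; exact: closed_conjset.
by apply/seteqP; split=> x Kx u /Kx; [move/conjsetE|move=> ?; apply/conjsetE].
Qed.

Lemma normalises_core U K : subgroup U -> normalises U (core U K).
Proof.
by move=> [_ UM _] u x Uu Kx v Uv; rewrite -conjgM; apply: Kx; exact: UM.
Qed.

(** Near 1, finite index in a closed subgroup becomes inclusion; this turns commensuration into a
    statement about elements. *)
Lemma commensurate_nbhs H L g : subgroup L -> subgroup H -> closed H ->
  covered (conjset g L) H -> exists2 V, nbhs (1 : G) V &
    forall x, L x -> V x -> H (x ^ g^-1).
Proof.
move=> sL sH cH c.
have [V nV VH] := closed_covered_nbhs (subgroup_conj g sL) sH cH c.
exists [set x | V (x ^ g^-1)]; first exact: nbhs1_conj.
move=> x Lx Vx; apply: VH; split=> //.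
by apply/conjsetE; rewrite conjgKV.
Qed.

Lemma commensurated_nbhs L g : subgroup L -> closed L -> commensurated L ->
  exists2 V, nbhs (1 : G) V & forall x, L x -> V x -> L (x ^ g).
Proof.
move=> sL cL /(_ g^-1)/commensurableE[||c _] //; first exact: subgroup_conj.
by have := commensurate_nbhs sL sL cL c; rewrite invgK.
Qed.

End Closure.

(** * Density and quasi-centralisers in the class S *)

Section ClassS.
Variable G : topologicalGroupType.
Hypothesis hG : class_S G.
Implicit Types (A B H K L M N U V : set G) (g x y : G).

Lemma hausdorffS : hausdorff_space G.
Proof. by case: hG => _ [_]. Qed.

Lemma closedS K : compact K -> closed K.
Proof. by apply: compact_closed; exact: hausdorffS. Qed.

Lemma closed_set1S x : closed [set x].
Proof. by apply: closedS; exact: compact_set1. Qed.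

Lemma small_cosubgroup B : nbhs (1 : G) B -> exists2 V, cosubgroup V & V `<=` B.
Proof. by have [_ [lcG hsG] tdG _ _] := hG; exact: van_dantzig. Qed.

Lemma nondiscreteS B : nbhs (1 : G) B -> exists2 x, B x & x <> 1.
Proof.
move=> nB; apply: contrapT => n; have [_ _ _ _ nd] := hG; apply: nd.
have n1 : nbhs (1 : G) [set 1].
  by apply: filterS nB => x Bx; apply: contrapT => x1; apply: n; exists x.
apply/funext => x; apply/seteqP; split=> A.
  by move=> /nbhs_singleton Ax y ->.
move=> /(_ x erefl) Ax; have : nbhs x [set y | [set 1] (x^-1 * y)].
  by apply: nbhs_lmul; rewrite mulVg.
by apply: filterS => y /= e; rewrite -[y](mulVKg x) e mulg1.
Qed.

(** The subgroup is the core of a small [V]. As [U] is covered by finitely many cosets of [V],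
    membership in the core is a condition on finitely many conjugates, hence open. *)
Lemma core_cosubgroup U B : cosubgroup U -> nbhs (1 : G) B ->
  exists V, [/\ cosubgroup V, V `<=` B, V `<=` U & normalises U V].
Proof.
move=> [sU cU oU] nB.
have nBU : nbhs (1 : G) (B `&` U) by apply: filterI => //; exact: open_nbhs1.
have [V [sV cV oV] VBU] := small_cosubgroup nBU.
have [s sP] := compact_covered cU sV oV.
have sW := @subgroup_core _ U V sV; have WV := @core_sub _ U V sU.
exists (core U V); split.
- split=> //.
    by apply: (subclosed_compact _ cV WV); apply: closed_core; exact: closedS.
  apply: nbhs_subgroup_open => //.
  have : nbhs (1 : G) [set x | forall g, g \in s -> V (x ^ g)].
    by apply: nbhs_seq => g _; apply: nbhs1_conj; exact: open_nbhs1.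
  apply: filterS => x Vx u /sP[g gs Vgu]; rewrite -(mulVKg g u) conjgM.
  have [V1 VM VV] := sV; have Vxg := Vx g gs.
  by rewrite conjgE; apply: (VM); [exact: VV|exact: VM].
- by move=> x /WV/VBU[].
- by move=> x /WV/VBU[].
- exact: normalises_core.
Qed.

Definition generates U (D : seq G) :=
  forall H, subgroup H -> U `<=` H -> (forall d, d \in D -> H d) -> H = setT.

Lemma exists_generators U : cosubgroup U ->
  exists D : seq G, (forall d, d \in D -> d^-1 \in D) /\ generates U D.
Proof.
move=> [sU cU oU]; case: hG => -[C cC CG] _ _ _ _.
have [s sP] := compact_covered cC sU oU.
exists (s ++ [seq d^-1 | d <- s]); split=> [d|H sH UH DH].
  rewrite !mem_cat => /orP[ds|/mapP[e es ->]]; last by rewrite invgK es.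
  by rewrite map_f ?orbT.
apply/seteqP; split=> // g _; have : smallest (@subgroup G) C g by rewrite CG.
apply; split=> // c /sP[d ds Ud]; rewrite -(mulVKg d c).
case: sH => _ HM _; apply: HM; last exact: UH.
by apply: DH; rewrite mem_cat ds.
Qed.

(** By topological simplicity the only other case is [L = G]. Then [U = G] is compact, and the core
    of a small open subgroup is a proper open normal subgroup, nontrivial because [G] is not
    discrete. *)
Lemma closed_normal_trivial U L : cosubgroup U -> subgroup L -> closed L ->
  L `<=` U -> normaliser L = setT -> L = [set 1].
Proof.
move=> cU sL cL LU nL; have tsG : topologically_simple G by case: hG.
have [//|LT] := tsG L (conj sL nL) cL; exfalso.
have UT : U = setT by apply/seteqP; split=> //; rewrite -LT.
have [x _ x1] := nondiscreteS filterT.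
have nx : nbhs (1 : G) (~` [set x]).
  apply: open_nbhs_nbhs; split; last by move=> /esym.
  exact/closed_openC/closed_set1S.
have [V [[sV cV oV] Vx _]] := core_cosubgroup cU nx.
rewrite UT => nV.
have [V1|VT] := tsG V (iffRL (normal_subgroupP V) (conj sV nV)) (closedS cV).
  have [y + y1] := nondiscreteS (open_nbhs1 sV oV).
  by rewrite V1.
have Vx' : V x by rewrite VT.
exact: Vx Vx' erefl.
Qed.

(** The closure of [N] is a nontrivial closed normal subgroup, so [N] is dense and meets the open
    set [gV]. *)
Lemma normal_dense N V g : normal_subgroup N -> N <> [set 1] ->
  subgroup V -> open V -> exists2 n, N n & V (n^-1 * g).
Proof.
move=> nN N1 sV oV; have tsG : topologically_simple G by case: hG.
have cNT : closure N = setT.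
  have [e|//] := tsG _ (normal_subgroup_closure nN) (@closed_closure _ N).
  case: N1; apply/seteqP; split=> [x Nx|x ->]; last by case: nN => -[].
  by rewrite -e; exact: subset_closure.
have : closure N g by rewrite cNT.
move=> /(_ (lcoset g V))[|n [Nn /lcosetE Vn]].
  apply: open_nbhs_nbhs; split; first exact: open_lcoset.
  by apply/lcosetE; rewrite mulVg; case: sV.
by exists n => //; case: sV => _ _ /(_ _ Vn); rewrite invgM invgK.
Qed.

(** Each generator [d] may be replaced by an element of the dense subgroup [N] in the coset [dU]. *)
Lemma normal_generators U D N : cosubgroup U -> generates U D ->
  normal_subgroup N -> N <> [set 1] ->
  exists f : G -> G, (forall d, N (f d) /\ U ((f d)^-1 * d)) /\
    (forall H, subgroup H -> U `<=` H -> (forall d, d \in D -> H (f d)) -> H = setT).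
Proof.
move=> [sU cU oU] gD nN N1.
have /choice[f fP] : forall d, exists n, N n /\ U (n^-1 * d).
  move=> d; have [n Nn Un] := normal_dense d nN N1 sU oU.
  by exists n.
exists f; split=> // H sH UH fH; apply: gD => // d dD.
rewrite -(mulVKg (f d) d); case: (sH) => _ HM _; apply: HM; first exact: fH.
by apply: UH; case: (fP d).
Qed.

Lemma subgroup_cosubgroup U : cosubgroup U -> subgroup U.
Proof. by case. Qed.

(* The elements of [N] centralise a common [U]-invariant open subgroup of [L],
   which is therefore normal in [G]. *)
Lemma quasicentralised_finite N L : normal_subgroup N -> N <> [set 1] ->
  locally_normal L ->
  (forall n, N n -> exists2 V, nbhs (1 : G) V & forall x, L x -> V x -> x ^ n = x) ->
  finite_set L.
Proof.
move=> nN N1 [sL cL oL] NL.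
have [U cU UL] := small_cosubgroup (open_nbhs1 (subgroup_normaliser L) oL).
have [sU cpU oU] := cU.
have [D [_ gD]] := exists_generators cU.
have [f [fP fG]] := normal_generators cU gD nN N1.
have /choice[V VP] : forall d, exists V, nbhs (1 : G) V /\
    forall x, L x -> V x -> x ^ (f d) = x.
  by move=> d; have [V nV VP] := NL _ (fP d).1; exists V.
have nB : nbhs (1 : G) [set x | forall d, d \in D -> V d x].
  by apply: nbhs_seq => d _; case: (VP d).
have [W [[sW cW oW] WB WU nW]] := core_cosubgroup cU nB.
have sLW := subgroupI sL sW.
have LW1 : L `&` W = [set 1].
  apply: closed_normal_trivial cU sLW _ _ _.
  - by apply: closedI; exact: closedS.
  - by move=> x [_ /WU].
  apply: fG; first exact: subgroup_normaliser.
    apply/normalises_normaliser => // u x Uu [Lx Wx]; split; last exact: nW.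
    by apply/conj_normaliserE => //; exact: UL.
  move=> d dD; have fix_ x : (L `&` W) x -> x ^ (f d) = x.
    by move=> [Lx /WB Bx]; have [_] := VP d; apply=> //; exact: Bx.
  apply/seteqP; split=> x.
    move=> /conjsetE LWx.
    by rewrite -(conjg_inj _ (fix_ _ LWx)).
  by move=> LWx; apply/conjsetE; rewrite fix_.
apply: covered1_finite; rewrite -LW1; apply: covered_setI => //.
exact: compact_covered.
Qed.

(** An element [k] of a finite [K] commutes with all [x] close to 1, since its conjugate by [x]
    stays in [K] and is close to [k]. A nontrivial [k] would make the quasi-centre [N] nontrivial,
    hence some compact open subgroup finite, against non-discreteness. *)
Lemma finite_locally_normal K : locally_normal K -> finite_set K -> K = [set 1].
Proof.
move=> [sK cK oK] fK; apply/seteqP; split=> [k Kk|x ->]; last by case: sK.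
apply: contrapT => k1.
pose N := [set n : G | exists2 V, nbhs (1 : G) V & forall x, V x -> x ^ n = x].
have nN : normal_subgroup N.
  apply/normal_subgroupP; split; first split.
  - by exists setT; [exact: filterT|move=> x _; rewrite conjg1].
  - move=> n m [V nV Vn] [V' nV' Vm]; exists (V `&` V'); first exact: filterI.
    by move=> x [Vx V'x]; rewrite conjgM Vn // Vm.
  - by move=> n [V nV Vn]; exists V => // x Vx; rewrite -{1}(Vn x Vx) conjgK.
  - move=> g n _ [V nV Vn]; exists [set x | V (x ^ g^-1)].
      exact: nbhs1_conj.
    by move=> x Vx; rewrite conjg_conj Vn // conjgKV.
have Nk : N k.
  (* For [y] equal to [x, k] the element [k * y^-1] is [k ^ x], so this neighbourhood keeps [k ^ x]
     away from the other elements of [K]. *)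
  have nKk : nbhs (1 : G) [set y | ~ (K `\ k) (k * y^-1)].
    have cKk : closed (K `\ k).
      apply: closedS; apply: finite_compact.
      by apply: sub_finite_set fK => x [].
    apply: (@nbhs_inv G 1 [set y | ~ (K `\ k) (k * y)]); rewrite invg1.
    apply: (@nbhs_lmul G k 1 (~` (K `\ k))); rewrite mulg1.
    apply: open_nbhs_nbhs; split; first exact: closed_openC.
    by move=> [_]; apply.
  exists ([set x | ~ (K `\ k) (k * (x^-1 * x ^ k)^-1)] `&` normaliser K).
    apply: filterI; first exact: (nbhs_commg k nKk).
    by apply: open_nbhs1 => //; exact: subgroup_normaliser.
  move=> x [/= nx Kx].
  have e : k * (x^-1 * x ^ k)^-1 = k ^ x by rewrite !conjgE !gnorm.
  rewrite e in nx; have kx : k ^ x = k.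
    apply: contrapT => kx; apply: nx; split=> //.
    exact/conj_normaliserE.
  by rewrite conjgE -{2}kx conjgE !gnorm.
have [U cU _] := small_cosubgroup filterT; have [sU cpU oU] := cU.
have fU : finite_set U.
  apply: (quasicentralised_finite nN).
  - by move=> N1; apply: k1; move: Nk; rewrite N1.
  - split=> //; apply: (open_subgroupS sU) => //; first exact: subgroup_normaliser.
    by apply/normalises_normaliser => //; exact: normalises_refl.
  - by move=> n [V nV Vn]; exists V => // x _; exact: Vn.
have [V nV VU] : exists2 V, nbhs (1 : G) V & U `&` V `<=` [set 1].
  apply: closed_covered_nbhs => //; first exact: subgroup1.
    exact: closed_set1S.
  by apply: finite_covered => //; exact: subgroup1.
have [x UVx x1] := nondiscreteS (filterI (open_nbhs1 sU oU) nV).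
by apply: x1; exact: VU.
Qed.

(** The quasi-centraliser [N] of [L] is normal because [L] is commensurated. If [K] and [L] met
    trivially, the elements of [K] normalising [L] would commute with those of [L] normalising [K],
    and so lie in [N]; then [N] is nontrivial and forces [L] to be finite. *)
Lemma commensurated_meet K L :
  locally_normal K -> locally_normal L -> commensurated L ->
  K <> [set 1] -> L <> [set 1] -> K `&` L <> [set 1].
Proof.
move=> lnK lnL cL K1 L1 KL1; have [[sK cK oK] [sL cpL oL]] := (lnK, lnL).
pose N := [set n : G | exists2 V, nbhs (1 : G) V & forall x, L x -> V x -> x ^ n = x].
have nN : normal_subgroup N.
  apply/normal_subgroupP; split; first split.
  - by exists setT; [exact: filterT|move=> x _ _; rewrite conjg1].
  - move=> n m [V nV Vn] [V' nV' Vm]; exists (V `&` V'); first exact: filterI.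
    by move=> x Lx [Vx V'x]; rewrite conjgM Vn // Vm.
  - by move=> n [V nV Vn]; exists V => // x Lx Vx; rewrite -{1}(Vn x Lx Vx) conjgK.
  - move=> g n _ [V nV Vn].
    have [V' nV' V'L] := commensurated_nbhs g^-1 sL (closedS cpL) cL.
    exists (V' `&` [set x | V (x ^ g^-1)]).
      by apply: filterI => //; exact: nbhs1_conj.
    move=> x Lx [V'x Vx]; rewrite conjg_conj Vn ?conjgKV //; exact: V'L.
have sKL : subgroup (K `&` normaliser L).
  by apply: subgroupI => //; exact: subgroup_normaliser.
apply: L1; apply: finite_locally_normal => //.
apply: (quasicentralised_finite nN) => // N1.
apply: K1; apply: finite_locally_normal => //.
have KN : K `&` normaliser L `<=` [set 1].
  rewrite -N1 => k [Kk Lk]; exists (normaliser K).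
    by apply: open_nbhs1 => //; exact: subgroup_normaliser.
  move=> x Lx Kx; have : (K `&` L) (x^-1 * x ^ k).
    split.
      rewrite -commgEl commgEr; case: sK => _ KM KV.
      by apply: KM => //; apply/conj_normaliserE => //; exact: KV.
    case: sL => _ LM LV; apply: LM; first exact: LV.
    exact/conj_normaliserE.
  by rewrite KL1 => /= e; rewrite -(mulVKg x (x ^ k)) e mulg1.
apply: covered1_finite; apply: coveredSr KN _; apply: covered_setI => //.
  exact: subgroup_normaliser.
by apply: compact_covered => //; exact: subgroup_normaliser.
Qed.

End ClassS.

(** * Words modulo a normal subgroup *)

Lemma count_pigeonhole (T : eqType) (s w : seq T) (t : nat) :
  (size s * t < count (mem s) w)%N -> exists2 c, c \in s & (t < count_mem c w)%N.
Proof.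
elim: s => [|y s IHs]; first by rewrite (@eq_count _ _ pred0) ?count_pred0.
move=> lt_st; have [le_yt|lt_ty] := leqP (count_mem y w) t; last first.
  by exists y; rewrite ?mem_head.
have [|c cs ltc] := IHs; last by exists c; rewrite // inE cs orbT.
have le_c : (count (mem (y :: s)) w <= count_mem y w + count (mem s) w)%N.
  rewrite -count_predUI; apply: leq_trans (leq_addr _ _).
  by apply: sub_count => x /=; rewrite inE.
have := leq_trans lt_st le_c; rewrite /= mulSn => h.
rewrite -(ltn_add2l t); apply: (leq_trans h).
by rewrite leq_add2r.
Qed.

(** The lists over [s] of length at most [n], as an explicit finite enumeration. *)
Fixpoint words (T : Type) (s : seq T) (n : nat) : seq (seq T) :=
  if n is n'.+1 then [::] :: [seq c :: w | c <- s, w <- words s n'] else [:: [::]].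

Lemma wordsP (T : eqType) (s w : seq T) n :
  {subset w <= s} -> (size w <= n)%N -> w \in words s n.
Proof.
elim: n w => [|n IHn] [|c w] //= ws le_wn.
rewrite inE; apply/orP; right; apply/allpairsP; exists (c, w); split=> //=.
  by apply: ws; rewrite mem_head.
by apply: IHn => // x xw; apply: ws; rewrite inE xw orbT.
Qed.

Section Words.
Variables (G : groupType) (U K : set G).
Hypotheses (sU : subgroup U) (sK : subgroup K) (KU : K `<=` U).
Hypothesis nUK : normalises U K.
Implicit Types (x y z u c : G) (w : seq G).

Definition eqmod x y := K (x^-1 * y).

Lemma eqmod_refl x : eqmod x x.
Proof. by rewrite /eqmod mulVg; case: sK. Qed.

Lemma eqmod_sym x y : eqmod x y -> eqmod y x.
Proof. by case: sK => _ _ KV /KV; rewrite invgM invgK. Qed.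

Lemma eqmod_trans y x z : eqmod x y -> eqmod y z -> eqmod x z.
Proof.
case: sK => _ KM _ xy yz; have := KM _ _ xy yz.
by rewrite !mulgA mulgK.
Qed.

Lemma eqmodM x x' y y' : U y ->
  eqmod x x' -> eqmod y y' -> eqmod (x * y) (x' * y').
Proof.
case: sK => _ KM _ Uy xx yy; have := KM _ _ (nUK Uy xx) yy.
by rewrite /eqmod conjgE !gnorm.
Qed.

Lemma eqmodMl x y y' : eqmod y y' -> eqmod (x * y) (x * y').
Proof. by rewrite /eqmod !gnorm. Qed.

Lemma eqmodJ u x y : U u -> eqmod x y -> eqmod (x ^ u) (y ^ u).
Proof. by move=> Uu /(nUK Uu); rewrite /eqmod conjMg conjVg. Qed.

Lemma eqmodX x y n : U x -> eqmod x y -> eqmod (x ^+ n) (y ^+ n).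
Proof.
move=> Ux xy; elim: n => [|n IHn]; first exact: eqmod_refl.
by rewrite !expgS; apply: eqmodM => //; exact: subgroupX.
Qed.

Lemma eqmod1 x : eqmod 1 x <-> K x.
Proof. by rewrite /eqmod invg1 mul1g. Qed.

Lemma eqmodK x y : eqmod x y -> K x -> K y.
Proof. by case: sK => _ KM _ xy Kx; have := KM _ _ Kx xy; rewrite mulVKg. Qed.

Lemma eqmodU x y : eqmod x y -> U x -> U y.
Proof. by case: sU => _ UM _ /KU xy Ux; have := UM _ _ Ux xy; rewrite mulVKg. Qed.

(** [Y] represents a finite set of cosets of [K] in [U] that is invariant under conjugation by
    [U]. *)
Variable Y : seq G.
Hypothesis YU : forall c, c \in Y -> U c.
Hypothesis YJ : forall u c, U u -> c \in Y -> exists2 c', c' \in Y & eqmod c' (c ^ u).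

Lemma wprodU w : {subset w <= Y} -> U (\prod_(c <- w) c).
Proof.
case: sU => U1 UM _; elim: w => [|c w IHw] wY; first by rewrite big_nil.
rewrite big_cons; apply: (UM); first by apply/YU/wY/mem_head.
by apply: IHw => x xw; apply: wY; rewrite inE xw orbT.
Qed.

Lemma wprodJ w u : {subset w <= Y} -> U u ->
  exists w', [/\ {subset w' <= Y}, size w' = size w &
    eqmod (\prod_(c <- w') c) ((\prod_(c <- w) c) ^ u)].
Proof.
move=> wY Uu; elim: w wY => [|c w IHw] wY.
  by exists [::]; split=> //; rewrite !big_nil conj1g; exact: eqmod_refl.
have [|w' [w'Y sw' ww']] := IHw; first by move=> x xw; apply: wY; rewrite inE xw orbT.
have [c' c'Y cc'] := YJ Uu (wY c (mem_head _ _)).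
exists (c' :: w'); split=> [x||]; last 1 first.
- by rewrite !big_cons conjMg; apply: eqmodM => //; exact: wprodU.
- by rewrite inE => /predU1P[->//|/w'Y].
- by rewrite /= sw'.
Qed.

(* Moving [c] to the front conjugates the letters that it passes. *)
Lemma collect_one w c : {subset w <= Y} -> c \in w ->
  exists w', [/\ {subset w' <= Y}, size w = (size w').+1,
    (count_mem c w <= (count_mem c w').+1)%N &
    eqmod (\prod_(x <- w) x) (c * \prod_(x <- w') x)].
Proof.
elim: w => [//|a w IHw] wY cw.
have wY' : {subset w <= Y} by move=> x xw; apply: wY; rewrite inE xw orbT.
have [ac|ac] := eqVneq a c.
  exists w; split=> //; first by rewrite /= ac eqxx.
  by rewrite big_cons ac; exact: eqmod_refl.
have {}cw : c \in w by move: cw; rewrite inE eq_sym (negPf ac).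
have [w' [w'Y sw cw' ww']] := IHw wY' cw.
have cY : c \in Y by exact: wY'.
have [a' a'Y aa'] := YJ (YU cY) (wY a (mem_head _ _)).
exists (a' :: w'); split.
- by move=> x; rewrite inE => /predU1P[->//|/w'Y].
- by rewrite /= sw.
- by rewrite /= (negPf ac) add0n (leq_trans cw') // ltnS leq_addl.
- rewrite !big_cons; apply: (eqmod_trans (eqmodMl a ww')).
  rewrite (_ : a * _ = c * (a ^ c * \prod_(x <- w') x)).
    by apply/eqmodMl/eqmodM; [exact: wprodU|exact: eqmod_sym|exact: eqmod_refl].
  by rewrite conjgE !gnorm.
Qed.

Lemma collect w c s : {subset w <= Y} -> (s <= count_mem c w)%N ->
  exists w', [/\ {subset w' <= Y}, size w = (s + size w')%N &
    eqmod (\prod_(x <- w) x) (c ^+ s * \prod_(x <- w') x)].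
Proof.
elim: s w => [|s IHs] w wY les.
  by exists w; split; rewrite // expg0 mul1g; exact: eqmod_refl.
have cw : c \in w by rewrite -has_pred1 has_count (leq_trans _ les).
have [w1 [w1Y sw1 cw1 ww1]] := collect_one wY cw.
have [|w' [w'Y sw' ww']] := IHs w1 w1Y.
  by rewrite -ltnS (leq_trans les).
exists w'; split=> //; first by rewrite sw1 sw'.
by rewrite expgS -mulgA; apply: (eqmod_trans ww1); exact: eqmodMl.
Qed.

(** By the pigeonhole principle some letter occurs more than [s] times; [collect] brings [s.+1]
    copies of it to the front. *)
Lemma collect_long w s : {subset w <= Y} -> (size Y * s < size w)%N ->
  exists c w', [/\ c \in Y, {subset w' <= Y}, size w = (s.+1 + size w')%N &
    eqmod (\prod_(x <- w) x) (c ^+ s.+1 * \prod_(x <- w') x)].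
Proof.
move=> wY lt_w; have [|c cY ltc] := @count_pigeonhole _ Y w s.
  rewrite (@eq_in_count _ _ predT) ?count_predT // => x; exact: wY.
have [w' [w'Y sw ww]] := collect wY ltc.
by exists c, w'; split.
Qed.

(** All letters share the power [z] modulo [K], so whichever letter is collected, a long word
    releases a factor [z]; this repeats until the word is short. *)
Lemma collect_power w s z : {subset w <= Y} -> U z ->
  (forall c, c \in Y -> eqmod (c ^+ s.+1) z) ->
  exists q w', [/\ {subset w' <= Y}, (size w' <= size Y * s)%N,
    size w = (q * s.+1 + size w')%N &
    eqmod (\prod_(x <- w) x) (z ^+ q * \prod_(x <- w') x)].
Proof.
move=> wY Uz Yz; have [n] := ubnP (size w); elim: n w wY => // n IHn w wY lt_wn.
have [le_w|lt_w] := leqP (size w) (size Y * s).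
  by exists 0%N, w; split; rewrite // expg0 mul1g; exact: eqmod_refl.
have [c [w1 [cY w1Y sw1 ww1]]] := collect_long wY lt_w.
have [|q [w' [w'Y sw' sw1' ww']]] := IHn w1 w1Y.
  by rewrite -ltnS (leq_trans _ lt_wn) // sw1 addSn !ltnS leq_addl.
exists q.+1, w'; split=> //; first by rewrite sw1 sw1' mulSn addnA.
apply: (eqmod_trans ww1); rewrite [z ^+ _]expgS -mulgA; apply: eqmodM.
- exact: wprodU.
- exact: Yz.
- exact: ww'.
Qed.

Lemma nat_seq_collision (T : eqType) (h : nat -> T) (s : seq T) :
  (forall j, h j \in s) -> exists j j', (j < j')%N /\ h j = h j'.
Proof.
move=> hs; apply: contrapT => n.
have u : uniq [seq h j | j <- iota 0 (size s).+1].
  rewrite map_inj_uniq ?iota_uniq // => j j' e.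
  by case: (ltngtP j j') => // lt; exfalso; apply: n; [exists j, j'|exists j', j].
have /(uniq_leq_size u) : {subset [seq h j | j <- iota 0 (size s).+1] <= s}.
  by move=> _ /mapP[j _ ->].
by rewrite size_map size_iota ltnn.
Qed.

(* A power [w ^ j] equals [z ^ q] times a short word with [q] growing with [j],
   and there are finitely many short words. *)
Lemma torsion_power s z w : U z -> (forall c, c \in Y -> eqmod (c ^+ s.+1) z) ->
  {subset w <= Y} -> (0 < size w)%N -> K (\prod_(x <- w) x) ->
  exists2 q, (0 < q)%N & K (z ^+ q).
Proof.
move=> Uz Yz wY w0 Kw.
have /choice[h hP] : forall j : nat, exists p : nat * seq G,
    [/\ {subset p.2 <= Y}, (size p.2 <= size Y * s)%N,
      (j * size w = p.1 * s.+1 + size p.2)%N & K (z ^+ p.1 * \prod_(x <- p.2) x)].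
  move=> j; pose wj := flatten (nseq j w).
  have wjY : {subset wj <= Y}.
    by move=> x /flattenP[v /nseqP[-> _] /wY].
  have Kwj : K (\prod_(x <- wj) x).
    rewrite /wj; elim: j {wj wjY} => [|j IHj]; first by rewrite big_nil; case: sK.
    by rewrite big_cat /=; case: sK => _ KM _; exact: KM.
  have swj : size wj = (j * size w)%N.
    by rewrite /wj; elim: j {wj wjY Kwj} => //= j IHj; rewrite size_cat IHj mulSn.
  have [q [w' [w'Y sw' sw e]]] := collect_power wjY Uz Yz.
  by exists (q, w'); split; rewrite //= -?swj //; exact: eqmodK e Kwj.
have [|j [j' [ltj e]]] := @nat_seq_collision _ (fun j => (h j).2) (words Y (size Y * s)).
  by move=> j; apply: wordsP; case: (hP j).
have [_ _ sj Kj] := hP j; have [_ _ sj' Kj'] := hP j'.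
have ltq : ((h j).1 < (h j').1)%N.
  have : (j * size w < j' * size w)%N by rewrite ltn_pmul2r.
  by rewrite sj sj' -e ltn_add2r ltn_pmul2r.
exists ((h j').1 - (h j).1)%N; first by rewrite subn_gt0.
move: Kj'; rewrite -{1}(subnK (ltnW ltq)) expgnDr -mulgA -e => Kj'.
case: sK => _ KM KV; have := KM _ _ Kj' (KV _ Kj).
by rewrite mulgK.
Qed.

(** Dietzmann's lemma modulo [K]: with a common exponent, [collect_power] for [z = 1] reduces every
    word over [Y] to one of bounded length, so the words fill finitely many cosets of [K]. *)
Lemma dietzmann : (forall c, c \in Y -> exists2 s, (0 < s)%N & K (c ^+ s)) ->
  exists E, [/\ subgroup E, K `<=` E /\ E `<=` U, normalises U E, covered E K &
    forall c, c \in Y -> E c].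
Proof.
move=> Yt.
have [s Ys] : exists s, forall c, c \in Y -> K (c ^+ s.+1).
  elim: (Y) Yt => [|c Z IHZ] Zt; first by exists 0%N.
  have [d dZ|s Zs] := IHZ; first by apply: Zt; rewrite inE dZ orbT.
  have [[//|t] _ Kt] := Zt c (mem_head _ _).
  exists (s.+1 * t.+1).-1 => d; rewrite prednK ?muln_gt0 //.
  rewrite inE => /predU1P[->|/Zs Kd]; last by rewrite expgnA; exact: subgroupX.
  by rewrite mulnC expgnA; exact: subgroupX.
have [U1 UM UV] := sU; have [K1 KM KV] := sK.
have Y1 c : c \in Y -> eqmod (c ^+ s.+1) 1.
  by move=> /Ys Kc; apply/eqmod_sym/eqmod1.
pose E := [set x | exists2 w, {subset w <= Y} & eqmod (\prod_(c <- w) c) x].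
have EU : E `<=` U by move=> x [w wY /eqmodU]; apply; exact: wprodU.
have EM x y : E x -> E y -> E (x * y).
  move=> [w wY wx] [v vY vy]; exists (w ++ v) => [c|].
    by rewrite mem_cat => /orP[/wY|/vY].
  by rewrite big_cat; apply: eqmodM => //; exact: wprodU.
have KE : K `<=` E.
  by move=> x Kx; exists [::] => //; rewrite big_nil; exact/eqmod1.
have EY c : c \in Y -> E c.
  move=> cY; exists [:: c]; first by move=> x; rewrite inE => /eqP->.
  by rewrite big_seq1; exact: eqmod_refl.
have EX x n : E x -> E (x ^+ n).
  move=> Ex; elim: n => [|n IHn]; first by apply/KE.
  by rewrite expgS; exact: EM.
(* Modulo [K] the inverse of [c] is the positive word [c ^+ s], so words without inverses already
   form a subgroup. *)
have EYV c : c \in Y -> E c^-1.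
  move=> cY; have := EM _ _ (KE _ (KV _ (Ys c cY))) (EX c s (EY c cY)).
  by rewrite expgSr invgM mulgVK.
exists E; split=> //; first split=> //.
- exact: KE.
- move=> x [w wY wx]; rewrite -(mulVKg (\prod_(c <- w) c) x) invgM.
  apply: (EM); first exact/KE/KV.
  elim: w wY {wx} => [|c w IHw] wY; first by rewrite big_nil invg1; exact: KE.
  rewrite big_cons invgM; apply: (EM); last by apply/EYV/wY/mem_head.
  by apply: IHw => x' xw; apply: wY; rewrite inE xw orbT.
- move=> u x Uu [w wY wx]; have [w' [w'Y _ ww']] := wprodJ wY Uu.
  by exists w' => //; apply: eqmod_trans ww' _; exact: eqmodJ.
exists [seq \prod_(c <- w) c | w <- words Y (size Y * s)] => x [w wY wx].
have [q [w' [w'Y sw' _]]] := collect_power wY U1 Y1.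
rewrite expg1n mul1g => e; exists (\prod_(c <- w') c); first exact/map_f/wordsP.
exact: eqmod_trans (eqmod_sym e) wx.
Qed.

End Words.

(** * Commutators near the identity *)

Lemma common_multiple (T : eqType) (l : seq T) (P : T -> nat -> Prop) :
  (forall g s t, P g s -> P g (s * t)%N) ->
  (forall g, g \in l -> exists2 s, (0 < s)%N & P g s) ->
  exists2 s, (0 < s)%N & forall g, g \in l -> P g s.
Proof.
move=> PM; elim: l => [|g l IHl] Pl; first by exists 1%N.
have [|s s0 Ps] := IHl; first by move=> h hl; apply: Pl; rewrite inE hl orbT.
have [t t0 Pt] := Pl g (mem_head _ _); exists (t * s)%N; first by rewrite muln_gt0 t0.
by move=> h; rewrite inE => /predU1P[->|/Ps Ph]; [|rewrite mulnC]; exact: PM.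
Qed.

Section Commensurated.
Variable G : topologicalGroupType.
Implicit Types (A B H K L M N U V : set G) (g x y : G).

(** The quasi-centraliser modulo [K]; for trivial [K] it is the quasi-centre of [G]. *)
Definition near_normaliser K : set G :=
  [set n | exists2 V, nbhs (1 : G) V & forall x, V x -> K (x^-1 * x ^ n)].

(** Uses [x, nm] = [x, m] [x, n]^m. Commensuration ensures that conjugation by [m] keeps the small
    element [x, n] of [K] inside [K]. *)
Lemma normal_near_normaliser K : subgroup K -> closed K -> commensurated K ->
  normal_subgroup (near_normaliser K).
Proof.
move=> sK cK comK; have [K1 KM KV] := sK.
apply/normal_subgroupP; split; first split.
- by exists setT; [exact: filterT|move=> x _; rewrite conjg1 mulVg].
- move=> n m [V nV Vn] [V' nV' Vm].
  have [V2 nV2 V2m] := commensurated_nbhs m sK cK comK.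
  exists (V `&` V' `&` [set x | V2 (x^-1 * x ^ n)]).
    by apply: filterI; [exact: filterI|exact: nbhs_commg].
  move=> x [[Vx V'x] V2x]; rewrite conjgM -(mulVKg x (x ^ n)) conjMg mulgA.
  apply: KM; first exact: Vm.
  by apply: V2m => //; exact: Vn.
- move=> n [V nV Vn]; exists [set x | V (x ^ n^-1)]; first exact: nbhs1_conj.
  by move=> x /Vn/KV; rewrite invgM invgK conjgKV.
- move=> g n _ [V nV Vn].
  have [V2 nV2 V2g] := commensurated_nbhs g sK cK comK.
  exists [set x | (V `&` [set x | V2 (x^-1 * x ^ n)]) (x ^ g^-1)].
    by apply: nbhs1_conj; apply: filterI => //; exact: nbhs_commg.
  move=> x [Vx V2x]; rewrite conjg_conj -{1}(conjgKV g x) -conjVg -conjMg.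
  by apply: V2g => //; exact: Vn.
Qed.

Lemma sub_near_normaliser K : subgroup K -> open (normaliser K) ->
  K `<=` near_normaliser K.
Proof.
move=> sK oK k Kk; exists (normaliser K).
  by apply: open_nbhs1 => //; exact: subgroup_normaliser.
move=> x Kx; rewrite -commgEl commgEr; case: sK => _ KM KV.
by apply: KM => //; apply/conj_normaliserE => //; exact: KV.
Qed.

Lemma closed_covered K E : subgroup K -> subgroup E -> closed K -> K `<=` E ->
  covered E K -> closed E.
Proof.
move=> sK [_ EM _] cK KE /(covered_rep sK)[s [sE sP]].
rewrite (_ : E = \bigcup_(g in [set` s]) lcoset g K).
  by apply: closed_bigcup => [|g _]; [exact: finite_seq|exact: closed_lcoset].
apply/seteqP; split=> [x /sP[g gs Kx]|x [g /= gs /lcosetE Kx]].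
  by exists g => //; apply/lcosetE.
by rewrite -(mulVKg g x); apply: EM; [exact: sE|exact: KE].
Qed.

(** Two different powers of [y] lie in the same coset of [V]. *)
Lemma power_covered U V y : subgroup U -> subgroup V -> covered U V -> U y ->
  exists2 t, (0 < t)%N & V (y ^+ t).
Proof.
move=> sU [V1 VM VV] [s sP] Uy.
have /choice[h hP] : forall j, exists g, g \in s /\ V (g^-1 * y ^+ j).
  by move=> j; have [|g gs Vg] := sP (y ^+ j); [exact: subgroupX|exists g].
have [|j [j' [ltj e]]] := @nat_seq_collision _ h s; first by move=> j; case: (hP j).
exists (j' - j)%N; first by rewrite subn_gt0.
have [[_ Vj] [_ Vj']] := (hP j, hP j').
rewrite -e in Vj'; have := VM _ _ (VV _ Vj) Vj'.
by rewrite -{1}(subnKC (ltnW ltj)) expgnDr invgM invgK !mulgA mulgK mulVg mul1g.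
Qed.

End Commensurated.

(** * Finiteness and torsion of commutators modulo a commensurated subgroup *)

Section Enlargement.
Variable G : topologicalGroupType.
Hypothesis hG : class_S G.
Implicit Types (A B H L M N V : set G) (g x y n u : G).
Variables (U K : set G).
Hypotheses (cU : cosubgroup U) (sK : subgroup K) (cK : closed K) (KU : K `<=` U).
Hypotheses (nUK : normalises U K) (comK : commensurated K).

Let sU : subgroup U. Proof. by case: cU. Qed.
Let Q := near_normaliser K.
Let eqK := eqmod K.

Let nQ : normal_subgroup Q. Proof. exact: normal_near_normaliser. Qed.

Let refl x : eqK x x. Proof. exact: eqmod_refl. Qed.
Let sym x y : eqK x y -> eqK y x. Proof. exact: eqmod_sym. Qed.

Lemma near_core n : Q n -> exists V, [/\ cosubgroup V, V `<=` U, normalises U V &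
  forall x, V x -> K (x^-1 * x ^ n)].
Proof.
move=> [B nB Bn]; have [V [cV VB VU nV]] := core_cosubgroup hG cU nB.
by exists V; split=> // x /VB/Bn.
Qed.

Lemma near_core_conj y V : (forall x, V x -> K (x^-1 * x ^ y)) ->
  forall x, V x -> eqK (y ^ x) y.
Proof.
move=> Vy x /Vy; rewrite /eqK /eqmod (_ : (y ^ x)^-1 * y = x^-1 * x ^ y) //.
by rewrite !conjgE !gnorm.
Qed.

(** Modulo [K], [y] commutes with a subgroup [V] that is open and normal in [U], so its conjugates
    under [U] are indexed by the finite quotient of [U] by [V]. *)
Lemma finite_class y : Q y -> U y -> exists Y : seq G,
  (forall c, c \in Y -> exists2 u, U u & c = y ^ u) /\
  (forall u, U u -> exists2 c, c \in Y & eqK c (y ^ u)).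
Proof.
move=> Qy Uy; have [V [[sV cV oV] VU nV Vy]] := near_core Qy.
have [_ cpU _] := cU.
have [s [sU' sP]] := covered_rep sV (compact_covered cpU sV oV).
exists [seq y ^ g | g <- s]; split=> [_ /mapP[g /sU' Ug ->]|u Uu]; first by exists g.
have [g gs Vgu] := sP u Uu; exists (y ^ g); first exact: map_f.
have Ug := sU' g gs; have UV : U g^-1 by case: sU => _ _; apply.
have e : u = (g^-1 * u) ^ g^-1 * g by rewrite conjgE !gnorm.
rewrite {1}e conjgM; apply: sym; apply: (eqmodJ nUK Ug).
by apply: near_core_conj Vy _ _; exact: nV.
Qed.

(* [u] may be replaced by an element [n] of [Q] close to it, and [n] fixes,
   modulo [K], all elements close to 1, such as a suitable power of [y]. *)
Lemma central_power y : Q y -> U y ->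
  exists2 s, (0 < s)%N & forall u, U u -> eqK ((y ^+ s) ^ u) (y ^+ s).
Proof.
move=> Qy Uy; have [V [[sV cV oV] VU nV Vy]] := near_core Qy.
have [_ cpU oU] := cU; have [U1 UM UV] := sU.
have [s [sU' sP]] := covered_rep sV (compact_covered cpU sV oV).
have [Q1|Q1] := pselect (Q = [set 1]).
  have -> : y = 1 by move: Qy; rewrite Q1.
  by exists 1%N => // u _; rewrite expg1 conj1g.
have /choice[f fP] : forall g, exists n, Q n /\ V (n^-1 * g).
  by move=> g; have [n Qn Vn] := normal_dense hG g nQ Q1 sV oV; exists n.
pose P g t := eqK ((y ^+ t) ^ (f g)) (y ^+ t).
have Uf g : U g -> U (f g).
  move=> Ug; have [_ /VU Ufg] := fP g.
  by have := UM _ _ Ug (UV _ Ufg); rewrite invgM invgK mulVKg.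
have [|g gs|t t0 Pt] := @common_multiple _ s (fun g t => U g -> P g t).
- move=> g t q Pt Ug; rewrite /P expgnA conjXg; apply: (eqmodX sU sK nUK) => //.
    by apply: normalises_refl; [|exact: Uf|exact: subgroupX].
  exact: Pt.
- have [V' [[sV' cV' oV'] _ _ V'f]] := near_core (fP g).1.
  have [t t0 V't] := power_covered sU sV' (compact_covered cpU sV' oV') Uy.
  by exists t => // Ug; apply: sym; exact: V'f.
exists t => // u Uu; have [g gs Vgu] := sP u Uu; have Ug := sU' g gs.
have VM : V ((f g)^-1 * u).
  by case: sV => _ VM _; have := VM _ _ (fP g).2 Vgu; rewrite mulgA mulgK.
rewrite -(mulVKg (f g) u) conjgM.
apply: (eqmod_trans sK (y := (y ^+ t) ^ ((f g)^-1 * u))).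
  by apply: (eqmodJ nUK); [exact: VU|exact: Pt].
rewrite conjXg; apply: (eqmodX sU sK nUK) => //; last exact: near_core_conj Vy _ _.
by apply: normalises_refl => //; exact: VU.
Qed.

(* A power of [x] is close to 1, so a product of conjugates of [x^-1 * x ^ n]
   lies in [K]. *)
Lemma commutator_torsion x n : U x -> Q n -> U (x ^ n) ->
  exists2 s, (0 < s)%N & K ((x^-1 * x ^ n) ^+ s).
Proof.
move=> Ux Qn Uxn; pose y := x^-1 * x ^ n.
have [U1 UM UV] := sU; have [_ cpU oU] := cU.
have Uy : U y by apply: UM => //; exact: UV.
have Qy : Q y.
  have /normal_subgroupP[[_ QM QV] QJ] := nQ.
  by rewrite /y -commgEl commgEr; apply: QM => //; apply: QJ => //; exact: QV.
have [Y [YU YJ]] := finite_class Qy Uy.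
have UJ u v : U u -> U v -> U (u ^ v) by move=> *; apply: normalises_refl.
have YU' c : c \in Y -> U c by move=> /YU[u Uu ->]; exact: UJ.
have YJ' u c : U u -> c \in Y -> exists2 c', c' \in Y & eqK c' (c ^ u).
  by move=> Uu /YU[v Uv ->]; rewrite -conjgM; apply: YJ; exact: UM.
have [[//|s] _ sP] := central_power Qy Uy.
have Yz c : c \in Y -> eqK (c ^+ s.+1) (y ^+ s.+1).
  by move=> /YU[v Uv ->]; rewrite -conjXg; exact: sP.
have [V [[sV cV oV] _ _ Vn]] := near_core Qn.
have [m m0 Vm] := power_covered sU sV (compact_covered cpU sV oV) Ux.
(* By [x^(k+1), n] = [x^k, n]^x [x, n], the commutator of [x ^+ m] is a word of exactly [m]
   conjugates of [y]. It lies in [K] since [x ^+ m] is in [V], and its positive length is what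
   [torsion_power] needs. *)
have [w [wY sw ew]] : exists w, [/\ {subset w <= Y}, size w = m &
    eqK (\prod_(c <- w) c) ((x ^+ m)^-1 * (x ^+ m) ^ n)].
  elim: (m) => [|k [w [wY sw ew]]].
    by exists [::]; split=> //; rewrite big_nil expg0 conj1g invg1 mulg1.
  have [w' [w'Y sw' ww']] := wprodJ sU sK nUK YU' YJ' wY Ux.
  have [c cY cy] := YJ 1 U1; rewrite conjg1 in cy.
  exists (w' ++ [:: c]); split.
  - by move=> d; rewrite mem_cat inE => /orP[/w'Y//|/eqP->].
  - by rewrite size_cat sw' sw addn1.
  rewrite big_cat big_seq1 /= !expgSr conjMg.
  rewrite (_ : _ * (_ * _) = ((x ^+ k)^-1 * (x ^+ k) ^ n) ^ x * y).
    apply: (eqmodM sK nUK) => //; first exact: YU'.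
    by apply: (eqmod_trans sK ww'); exact: (eqmodJ nUK).
  by rewrite /y [in RHS]conjgE !gnorm.
have Kw : K (\prod_(c <- w) c) by apply: (eqmodK sK (sym ew)); exact: Vn.
have w0 : (0 < size w)%N by rewrite sw.
have Uz : U (y ^+ s.+1) by exact: subgroupX.
have [q q0 Kq] := torsion_power sU sK nUK YU' YJ' Uz Yz wY w0 Kw.
by exists (s.+1 * q)%N; rewrite ?muln_gt0 // expgnA.
Qed.

(** For [v] in a small [V], [av, n] agrees with [a, n]^v modulo [K]. Hence finitely many
    representatives [a] and the finite class of each [a, n] suffice. *)
Lemma commutator_classes A n : Q n -> A `<=` U -> (forall x, A x -> U (x ^ n)) ->
  exists Y : seq G, [/\ forall c, c \in Y -> U c,
    forall u c, U u -> c \in Y -> exists2 c', c' \in Y & eqK c' (c ^ u),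
    forall c, c \in Y -> exists2 s, (0 < s)%N & K (c ^+ s) &
    forall x, A x -> exists2 c, c \in Y & eqK c (x^-1 * x ^ n)].
Proof.
move=> Qn AU An; have [U1 UM UV] := sU; have [_ cpU oU] := cU.
have UJ u v : U u -> U v -> U (u ^ v) by move=> *; apply: normalises_refl.
have [V [[sV cV oV] VU _ Vn]] := near_core Qn.
have [s [sA sP]] := covered_rep sV (coveredS AU (compact_covered cpU sV oV)).
pose y a := a^-1 * a ^ n.
have Uy a : A a -> U (y a) by move=> Aa; apply: (UM); [exact/UV/AU|exact: An].
have Qy a : A a -> Q (y a).
  have /normal_subgroupP[[_ QM QV] QJ] := nQ => Aa.
  by rewrite /y -commgEl commgEr; apply: QM => //; apply: QJ => //; exact: QV.
have /choice[Z ZP] : forall a, exists Y : seq G, A a ->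
    (forall c, c \in Y -> exists2 u, U u & c = y a ^ u) /\
    (forall u, U u -> exists2 c, c \in Y & eqK c (y a ^ u)).
  move=> a; have [Aa|nA] := pselect (A a); last by exists [::].
  by have [Y YP] := finite_class (Qy a Aa) (Uy a Aa); exists Y.
have inZ c : c \in flatten [seq Z a | a <- s] ->
    exists a u, [/\ a \in s, A a, U u & c = y a ^ u].
  move=> /flatten_mapP[a sa cZ]; have Aa := sA a sa.
  by have [+ _] := ZP a Aa => /(_ c cZ)[u Uu ->]; exists a, u.
have Zin a u : a \in s -> U u ->
    exists2 c, c \in flatten [seq Z a | a <- s] & eqK c (y a ^ u).
  move=> sa Uu; have [_ /(_ u Uu)[c cZ cu]] := ZP a (sA a sa).
  by exists c => //; apply/flatten_mapP; exists a.
exists (flatten [seq Z a | a <- s]); split.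
- by move=> c /inZ[a [u [_ Aa Uu ->]]]; apply: UJ => //; exact: Uy.
- move=> v c Uv /inZ[a [u [sa Aa Uu ->]]].
  by rewrite -conjgM; apply: Zin => //; exact: UM.
- move=> c /inZ[a [u [sa Aa Uu ->]]].
  have [t t0 Kt] := commutator_torsion (AU a Aa) Qn (An a Aa).
  by exists t => //; rewrite -conjXg; exact: nUK.
move=> x Ax; have [a sa Vax] := sP x Ax.
have Uo : U (a^-1 * x) by exact: VU.
have [c cZ cy] := Zin a _ sa Uo; exists c => //.
apply: (eqmod_trans sK cy); rewrite /eqmod.
have := Vn _ Vax; rewrite conjMg conjVg.
congr K; rewrite /y !conjgE !gnorm //.
Qed.

End Enlargement.

(** * The least commensurated class *)

Section Products.
Variable G : groupType.
Implicit Types (A B K L M : set G) (g x : G).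

Lemma subgroup_mulset A B : subgroup A -> subgroup B -> normalises B A ->
  subgroup (mulset A B).
Proof.
move=> [A1 AM AV] [B1 BM BV] nBA; split.
- by exists 1 => //; exists 1; rewrite ?mulg1.
- move=> _ _ [a Aa [b Bb <-]] [a' Aa' [b' Bb' <-]].
  exists (a * a' ^ b^-1); first by apply: AM => //; apply: nBA => //; exact: BV.
  exists (b * b'); first exact: BM.
  by rewrite conjgE !gnorm.
- move=> _ [a Aa [b Bb <-]]; exists (a^-1 ^ b).
    by apply: nBA => //; exact: AV.
  by exists b^-1; [exact: BV|rewrite conjgE !gnorm].
Qed.

Lemma covered_mulset A B : subgroup B -> covered A B -> covered (mulset A B) B.
Proof.
move=> [_ BM _] [s sP]; exists s => _ [a /sP[g gs Bg] [b Bb <-]].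
by exists g => //; rewrite mulgA; exact: BM.
Qed.

Lemma covered_seq K (s : seq G) (M : G -> set G) : subgroup K ->
  (forall g, subgroup (M g)) -> (forall g, g \in s -> covered K (M g)) ->
  covered K [set x | forall g, g \in s -> M g x].
Proof.
move=> sK sM; elim: s => [|h s IHs] KM.
  by apply: coveredSr (covered_refl K) => x _ g.
have sI : subgroup [set x | forall g, g \in s -> M g x].
  rewrite (_ : mkset _ = \bigcap_(g in [set` s]) M g).
    exact: subgroup_bigcap.
  by apply/seteqP; split=> x Mx g /Mx.
have KI : covered K [set x | forall g, g \in s -> M g x].
  by apply: IHs => g gs; apply: KM; rewrite inE gs orbT.
apply: coveredSr (covered_setI2 sK (sM h) sI (KM h (mem_head _ _)) KI).
by move=> x [Mx Ix] g; rewrite inE => /predU1P[->|/Ix].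
Qed.

Lemma commensuratedS K L : subgroup K -> subgroup L ->
  covered K L -> covered L K -> commensurated L -> commensurated K.
Proof.
move=> sK sL KL LK cL g; have sKg := subgroup_conj g sK.
have sLg := subgroup_conj g sL.
have /(commensurableE sLg sL)[gL Lg] := cL g.
apply/(commensurableE sKg sK); split.
  exact: covered_trans (covered_conj g KL) (covered_trans gL LK).
exact: covered_trans KL (covered_trans Lg (covered_conj g LK)).
Qed.

End Products.

Section Classes.
Variable G : topologicalGroupType.
Implicit Types (K L : set G).

Lemma LNclassP (a : LN G) : exists K (lnK : locally_normal K), a = LNclass (LNSub lnK).
Proof.
exists (lnsub_set (repr a)), (lnsubP (repr a)); rewrite -{1}[a]reprK.
apply/LNclass_eq; rewrite /lnsub_set /=.
exact/commensurable_refl/lnsub_subgroup.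
Qed.

Lemma LNclass_le K L (lnK : locally_normal K) (lnL : locally_normal L) :
  (LNclass (LNSub lnK) <= LNclass (LNSub lnL))%O <-> covered K L.
Proof.
have [[sK _ _] [sL _ _]] := (lnK, lnL).
have := LN_leE (LNSub lnK) (LNSub lnL); rewrite /lnsub_set /= => h.
by rewrite -finite_index_covered.
Qed.

Lemma LNclass_fixed K (lnK : locally_normal K) :
  LNfixed G (LNclass (LNSub lnK)) <-> commensurated K.
Proof.
split=> cK g; last first.
  by rewrite LNactE; apply/LNclass_eq; exact: cK.
by have := cK g; rewrite LNactE => /LNclass_eq.
Qed.

End Classes.

Section LocallyStable.
Variable G : topologicalGroupType.
Hypothesis hG : class_S G.
Implicit Types (A B H K L M N U V W : set G) (g x y n u : G).

Lemma LNclass0 K (lnK : locally_normal K) :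
  LNclass (LNSub lnK) = LN0 <-> K = [set 1].
Proof.
have [sK cK _] := lnK; split=> [/LNclass_eq|K1].
  move=> /(commensurableE sK (@subgroup1 G))[c _].
  exact/(finite_locally_normal hG lnK)/covered1_finite.
apply/LNclass_eq; rewrite /lnsub_set /= K1; apply: commensurable_refl.
exact: subgroup1.
Qed.

(* [K] normalises [K * (L `&` U)], which is commensurable with [L]; hence the
   dense normal subgroup generated by [K] commensurates [L]. *)
Lemma commensurated_above K L : locally_normal K -> locally_normal L ->
  commensurated K -> K <> [set 1] -> covered K L -> commensurated L.
Proof.
move=> lnK lnL cK K1 KL; have [sK cpK oK] := lnK.
have [U [sU cpU oU] UK] := small_cosubgroup hG (open_nbhs1 (subgroup_normaliser K) oK).
(* Quantifying over all classes above that of [K] makes [N] normal: a conjugate of such a subgroup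
   is again above [K], because [K] is commensurated. *)
pose N := [set n | forall L, locally_normal L -> covered K L -> commensurator L n].
have nN : normal_subgroup N.
  apply/normal_subgroupP; split; first split.
  - by move=> A [sA _ _] _; have [] := subgroup_commensurator sA.
  - move=> n m Nn Nm A lnA cA; have [sA _ _] := lnA.
    by have [_ CM _] := subgroup_commensurator sA; apply: CM; [exact: Nn|exact: Nm].
  - move=> n Nn A lnA cA; have [sA _ _] := lnA.
    by have [_ _ CV] := subgroup_commensurator sA; apply: CV; exact: Nn.
  - move=> g n _ Nn A lnA cA; have [sA _ _] := lnA.
    have sAg := subgroup_conj g sA.
    have /Nn : locally_normal (conjset g A) by exact: locally_normal_conj.
    have cKg : covered K (conjset g A).
      apply: covered_trans (covered_conj g cA).
      by have [] := commensurableE (subgroup_conj g sK) sK => /(_ (cK g))[].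
    move=> /(_ cKg)/(commensurableE (subgroup_conj n sAg) sAg)[c1 c2].
    apply/(commensurableE (subgroup_conj _ sA) sA).
    rewrite conjgE !conjsetM.
    have := covered_conj g^-1 c1; have := covered_conj g^-1 c2.
    by rewrite -[conjset g^-1 (conjset g A)]conjsetM mulVg conjset1.
have N1 : N <> [set 1].
  move=> N1; apply: K1; apply: (finite_locally_normal hG lnK).
  apply: covered1_finite; rewrite -N1.
  apply: coveredSr (covered_setI sK sU (compact_covered cpK sU oU)) => k [Kk Uk].
  move=> A [sA cA oA] KA; have sKU := subgroupI sK sU; have sAU := subgroupI sA sU.
  have sB : subgroup (mulset (K `&` U) (A `&` U)).
    apply: subgroup_mulset => // u x [_ Uu] [Kx Ux]; split.
      by apply/conj_normaliserE => //; exact: UK.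
    exact: normalises_refl.
  have Bk : mulset (K `&` U) (A `&` U) k.
    by exists k => //; exists 1; [case: sAU|rewrite mulg1].
  have AB : covered A (mulset (K `&` U) (A `&` U)).
    apply: coveredSr (covered_setI sA sU (compact_covered cA sU oU)) => x Ax.
    by exists 1; [case: sKU|exists x; rewrite ?mul1g].
  have BA : covered (mulset (K `&` U) (A `&` U)) A.
    apply: (@coveredSr _ _ (A `&` U)); first by move=> x [].
    apply: covered_mulset => //.
    have : covered (K `&` U) (K `&` U `&` A).
      by apply: covered_setI => //; apply: coveredS KA => x [].
    by apply: coveredSr => x [[_ Ux] Ax].
  have nB : conjset k (mulset (K `&` U) (A `&` U)) = mulset (K `&` U) (A `&` U).
    exact: (iffLR (normalises_normaliser _ sB) (normalises_refl sB)).
  have c1 := covered_conj k AB; have c2 := covered_conj k BA.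
  rewrite nB in c1 c2; apply/(commensurableE (subgroup_conj _ sA) sA); split.
    exact: covered_trans c1 BA.
  exact: covered_trans AB c2.
have [sL _ oL] := lnL; move=> g.
have [n Nn Lg] := normal_dense hG g nN N1 (subgroup_normaliser L) oL.
have [_ CM _] := subgroup_commensurator sL.
rewrite -(mulVKg n g); apply: CM; first exact: Nn.
exact: normaliser_commensurator.
Qed.

(** The convenient representatives of the fixed classes: closed normal subgroups of [U] that [G]
    commensurates. *)
Definition admissible U K := [/\ subgroup K, closed K, K `<=` U,
  normalises U K & commensurated K].

Lemma admissible_locally_normal U K : cosubgroup U -> admissible U K -> locally_normal K.
Proof.
move=> [sU cU oU] [sK cK KU nK _]; split=> //; first exact: subclosed_compact cU KU.
apply: (open_subgroupS sU) => //; first exact: subgroup_normaliser.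
exact/normalises_normaliser.
Qed.

(** Take the core in [U] of the part of [K] inside [U]. Since the normaliser of [K] is open,
    finitely many conjugates of [K] determine this core, and each of them is commensurable with
    [K]. *)
Lemma admissible_representative U K : cosubgroup U -> locally_normal K ->
  commensurated K -> exists A, [/\ admissible U A, covered K A & covered A K].
Proof.
move=> [sU cU oU] [sK cpK oK] cK; have sN := subgroup_normaliser K.
have sKU := subgroupI sK sU.
pose A := core U (K `&` U); have sA : subgroup A := subgroup_core U sKU.
have AK : A `<=` K `&` U by exact: core_sub.
have cA : covered A K.
  by apply: coveredS (covered_refl K) => x /AK[].
have cAK : covered K A.
  have sUN := subgroupI sU sN.
  have [s [sU' sP]] : exists s : seq G, (forall g, g \in s -> U g) /\
      forall x, U x -> exists2 g, g \in s & (U `&` normaliser K) (g^-1 * x).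
    apply: covered_rep => //; apply: covered_setI => //.
    exact: compact_covered.
  have sI : subgroup [set x | forall g, g \in s -> conjset g K x].
    rewrite (_ : mkset _ = \bigcap_(g in [set` s]) conjset g K).
      by apply: subgroup_bigcap => g _; exact: subgroup_conj.
    by apply/seteqP; split=> x Mx g /Mx.
  have KI : covered K [set x | forall g, g \in s -> conjset g K x].
    apply: covered_seq => // g; first exact: subgroup_conj.
    by move=> _; have /(commensurableE (subgroup_conj g sK) sK)[] := cK g.
  have := covered_setI2 sK sU sI (compact_covered cpK sU oU) KI.
  apply: coveredSr => x [Ux Kx] u Uu; split; last exact: normalises_refl.
  have [g gs [_ Ngu]] := sP u Uu; rewrite -(mulVKg g u) conjgM.
  by apply/conj_normaliserE => //; apply/conjsetE; exact: Kx.
exists A; split=> //; split=> //.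
- apply: closed_core; apply: closedI; first exact: (closedS hG).
  exact: open_subgroup_closed.
- by move=> x /AK[].
- exact: normalises_core.
- exact: commensuratedS cA cAK cK.
Qed.

(* As [W] and [D] do not depend on [L], this property passes to arbitrary
   intersections, unlike being commensurated. *)
Definition locally_stable U W (D : seq G) L := [/\ subgroup L, closed L, L `<=` U,
  normalises U L & forall d x, d \in D -> L x -> W x -> L (x ^ d)].

(** Choose [f d] in [Q] and in [dU]. Dietzmann's lemma yields a finite extension [E] of [K]
    containing all [x, f d] with [x] in [W], so [x ^ f d] stays in [E]; passing from [f d] to [d]
    costs an element of [U], which normalises [E]. *)
Lemma locally_stable_enlargement U W (D : seq G) K : cosubgroup U -> W `<=` U ->
  (forall d x, d \in D -> W x -> U (x ^ d)) ->
  admissible U K -> K <> [set 1] ->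
  exists E, [/\ locally_stable U W D E, K `<=` E & covered E K].
Proof.
move=> cU WU WD aK K1; have [sK cK KU nK comK] := aK; have [sU cpU oU] := cU.
have [_ _ oK] := admissible_locally_normal cU aK.
pose Q := near_normaliser K; have nQ : normal_subgroup Q by exact: normal_near_normaliser.
have KQ : K `<=` Q by exact: sub_near_normaliser.
have Q1 : Q <> [set 1].
  move=> Q1; apply: K1; apply/seteqP; split=> [x /KQ|x ->]; first by rewrite Q1.
  by case: sK.
have /choice[f fP] : forall d, exists n, Q n /\ U (n^-1 * d).
  by move=> d; have [n Qn Un] := normal_dense hG d nQ Q1 sU oU; exists n.
have fW d x : d \in D -> W x -> U (x ^ f d).
  move=> dD Wx; have [_ Ud] := fP d.
  have -> : f d = d * (((f d)^-1 * d)^-1) by rewrite !gnorm.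
  rewrite conjgM; apply: normalises_refl => //; last exact: WD.
  by case: sU => _ _; apply.
have [Y [YU YJ Yt YW]] : exists Y : seq G, [/\ forall c, c \in Y -> U c,
    forall u c, U u -> c \in Y -> exists2 c', c' \in Y & eqmod K c' (c ^ u),
    forall c, c \in Y -> exists2 s, (0 < s)%N & K (c ^+ s) &
    forall d x, d \in D -> W x -> exists2 c, c \in Y & eqmod K c (x^-1 * x ^ f d)].
  elim: (D) fW => [|d E IHE] fW; first by exists [::].
  have [|Y [YU YJ Yt YW]] := IHE.
    by move=> e x eE; apply: fW; rewrite inE eE orbT.
  have [|Z [ZU ZJ Zt ZW]] :=
    @commutator_classes _ hG U K cU sK cK nK comK W (f d) (fP d).1 WU.
    by move=> x; apply: fW; exact: mem_head.
  exists (Z ++ Y); split.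
  - by move=> c; rewrite mem_cat => /orP[/ZU|/YU].
  - move=> u c Uu; rewrite mem_cat => /orP[/(ZJ u c Uu)|/(YJ u c Uu)] [c' c'Y e];
      by exists c'; rewrite // mem_cat c'Y ?orbT.
  - by move=> c; rewrite mem_cat => /orP[/Zt|/Yt].
  - move=> e x; rewrite inE => /predU1P[->|eE] Wx.
      by have [c cZ cx] := ZW x Wx; exists c; rewrite // mem_cat cZ.
    by have [c cY cx] := YW e x eE Wx; exists c; rewrite // mem_cat cY orbT.
have [E [sE [KE EU] nE cE YE]] := dietzmann sU sK KU nK YU YJ Yt.
exists E; split=> //; split=> //; first exact: closed_covered cE.
move=> d x dD Ex Wx; have [c cY cx] := YW d x dD Wx.
have [_ EM _] := sE.
have Ef : E (x ^ f d).
  rewrite -(mulVKg x (x ^ f d)); apply: (EM) => //.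
  by rewrite -(mulVKg c (_ * _)); apply: EM; [exact: YE|exact: KE].
by rewrite -(mulVKg (f d) d) conjgM; apply: nE => //; case: (fP d).
Qed.

(** The part of [L] in [W] has finite index in [L] and every [d] carries it into [L]; as [D] is
    symmetric, [d] commensurates [L]. *)
Lemma locally_stable_admissible U W (D : seq G) L : cosubgroup U -> cosubgroup W ->
  generates U D -> (forall d, d \in D -> d^-1 \in D) ->
  locally_stable U W D L -> admissible U L.
Proof.
move=> [sU cU oU] [sW _ oW] gD DV [sL cL LU nL LD]; split=> //.
have cpL : compact L by exact: subclosed_compact cU LU.
suff : commensurator L = setT by move=> e g; have : commensurator L g by rewrite e.
apply: gD; first exact: subgroup_commensurator.
  apply: subset_trans (normaliser_commensurator sL).
  exact/normalises_normaliser.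
move=> d dD; have LLW := covered_setI sL sW (compact_covered cpL sW oW).
apply/(commensurableE (subgroup_conj d sL) sL); split.
  apply: (covered_trans (covered_conj d LLW)).
  apply: coveredS (covered_refl L) => x /conjsetE[Lx Wx].
  by rewrite -(conjgK d x); apply: LD => //; exact: DV.
apply: coveredSr LLW => x [Lx Wx]; apply/conjsetE; exact: LD.
Qed.

(** If [L] were inside [W], both [U] and [D] would normalise it, and a closed normal subgroup of [G]
    inside [U] is trivial. *)
Lemma locally_stable_meets U W (D : seq G) L : cosubgroup U ->
  generates U D -> (forall d, d \in D -> d^-1 \in D) ->
  locally_stable U W D L -> L <> [set 1] -> L `&` ~` W !=set0.
Proof.
move=> cU gD DV [sL cL LU nL LD] L1; apply: contrapT => nLW; apply: L1.
have sU := subgroup_cosubgroup cU.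
apply: (closed_normal_trivial hG cU) => //.
have LW : L `<=` W by move=> x Lx; apply: contrapT => nWx; apply: nLW; exists x.
apply: gD; first exact: subgroup_normaliser.
  exact/normalises_normaliser.
move=> d dD; apply/seteqP; split=> x.
  by move=> /conjsetE Lx; rewrite -(conjgK d x); apply: LD => //; [exact: DV|exact: LW].
by move=> Lx; apply/conjsetE; apply: LD => //; exact: LW.
Qed.

Lemma exists_least_commensurated U : cosubgroup U -> exists M,
  [/\ admissible U M, M <> [set 1] &
    forall K, locally_normal K -> commensurated K -> K <> [set 1] -> covered M K].
Proof.
move=> cU; have [sU cpU oU] := cU.
have [D [DV gD]] := exists_generators hG cU.
have nB : nbhs (1 : G) [set x | forall d, d \in D -> U (x ^ d)].
  by apply: nbhs_seq => d _; apply: nbhs1_conj; exact: open_nbhs1.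
have [W [cW WD WU nW]] := core_cosubgroup hG cU nB.
have [sW _ oW] := cW.
have WD' d x : d \in D -> W x -> U (x ^ d) by move=> dD /WD; apply.
pose F := [set L | locally_stable U W D L /\ L <> [set 1]].
have aF L : F L -> admissible U L.
  by move=> [pL _]; exact: locally_stable_admissible pL.
have FU : F U.
  split; first by split=> //; [exact: open_subgroup_closed|exact: normalises_refl
    |move=> d x dD _; exact: WD'].
  by move=> U1; have [x + x1] := nondiscreteS hG (open_nbhs1 sU oU); rewrite U1.
have FI L L' : F L -> F L' -> F (L `&` L').
  move=> FL FL'; have [[[sL cL LU nL LD] L1] [[sL' cL' LU' nL' LD'] L1']] := (FL, FL').
  split; last first.
    apply: (commensurated_meet hG) => //.
    - exact/(admissible_locally_normal cU)/aF.
    - exact/(admissible_locally_normal cU)/aF.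
    - by case: (aF _ FL').
  split=> //; [exact: subgroupI|exact: closedI|by move=> x [/LU]|
    by move=> u x Uu [Lx L'x]; split; [exact: nL|exact: nL']|
    by move=> d x dD [Lx L'x] Wx; split; [exact: LD|exact: LD']].
pose M := \bigcap_(L in F) L.
have pM : locally_stable U W D M.
  split.
  - by apply: subgroup_bigcap => L [[]].
  - by apply: closed_bigI => L [[]].
  - by move=> x /(_ U FU).
  - by move=> u x Uu Mx L FL; have [[_ _ _ nL _] _] := FL; apply: nL => //; exact: Mx.
  - move=> d x dD Mx Wx L FL; have [[_ _ _ _ LD] _] := FL.
    by apply: LD => //; exact: Mx.
(* The members of [F] have nonempty traces outside [W], directed by [FI]; a common point [x] outside
   [W] shows that [M] is nontrivial. *)
have [|L FL|L L' FL FL'|L FL|x Ux Mx] :=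
    @compact_directed _ U (set G) F (fun L => L `&` ~` W) cpU.
- by exists U.
- by apply: closedI; [case: FL => -[]|exact: open_closedC].
- by exists (L `&` L'); [exact: FI|move=> x [[]]].
- have [pL L1] := FL; have [x [Lx nWx]] := locally_stable_meets cU gD DV pL L1.
  by exists x; split=> //; case: pL => _ _ LU *; exact: LU.
have M1 : M <> [set 1].
  move=> M1; have [_] := Mx U FU; apply.
  have : M x by move=> L /Mx[].
  by rewrite M1 => ->; case: sW.
exists M; split=> //; first exact: locally_stable_admissible pM.
move=> K lnK cK K1; have [sK _ _] := lnK.
have [A [aA KA AK]] := admissible_representative cU lnK cK.
have [sA _ _ _ _] := aA.
have [|E [pE AE EA]] := locally_stable_enlargement cU WU WD' aA.
  move=> A1; apply: K1; apply: (finite_locally_normal hG lnK).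
  by apply: covered1_finite; rewrite -A1.
apply: (covered_trans _ AK); apply: coveredS EA.
have FE : F E.
  split=> // E1; apply: K1; apply: (finite_locally_normal hG lnK).
  by apply: covered1_finite; rewrite -E1; exact: coveredSr AE KA.
by move=> y /(_ E FE).
Qed.

End LocallyStable.

(** * Products of conjugates *)

Section BigProducts.
Variables (G : groupType) (I : eqType).
Implicit Types (A B K L M N V : set G) (g x : G) (s t : seq I) (F : I -> set G).

Local Notation prods s F := (\big[@mulset G/[set 1]]_(h <- s) F h).

Lemma prods_cat s t F x y : prods s F x -> prods t F y -> prods (s ++ t) F (x * y).
Proof.
elim: s x => [|h s IHs] x; first by rewrite big_nil => -> ty; rewrite mul1g.
rewrite !big_cons => -[a Fa [b sb <-]] ty; exists a => //.
by exists (b * y); [exact: IHs|rewrite mulgA].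
Qed.

Lemma prods1 h F x : F h x -> prods [:: h] F x.
Proof.
move=> Fx; rewrite big_cons big_nil.
by exists x => //; exists 1; rewrite ?mulg1.
Qed.

Lemma prodsV s F F' x : (forall h a, F h a -> F' h a^-1) ->
  prods s F x -> prods (rev s) F' x^-1.
Proof.
move=> FF; elim: s x => [|h s IHs] x.
  by rewrite !big_nil => ->; rewrite invg1.
rewrite big_cons => -[a Fa [b sb <-]].
rewrite invgM rev_cons -cats1; apply: prods_cat; first exact: IHs.
by apply: prods1; exact: FF.
Qed.

Lemma prodsJ s F F' (f : I -> I) g x : (forall h a, F h a -> F' (f h) (a ^ g)) ->
  prods s F x -> prods [seq f h | h <- s] F' (x ^ g).
Proof.
move=> FF; elim: s x => [|h s IHs] x.
  by rewrite !big_nil => ->; rewrite conj1g.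
rewrite !big_cons => -[a Fa [b sb <-]]; rewrite conjMg.
by exists (a ^ g); [exact: FF|exists (b ^ g) => //; exact: IHs].
Qed.

Lemma prods_min N s F : subgroup N -> (forall h, h \in s -> F h `<=` N) ->
  prods s F `<=` N.
Proof.
move=> [N1 NM _]; elim: s => [|h s IHs] FN x; first by rewrite big_nil => ->.
rewrite big_cons => -[a Fa [b sb <-]]; apply: NM.
  exact: FN (mem_head _ _) _ Fa.
by apply: IHs sb => g gs; apply: FN; rewrite inE gs orbT.
Qed.

Lemma prodsS s F F' : (forall h, F h `<=` F' h) -> prods s F `<=` prods s F'.
Proof.
move=> FF; elim: s => [|h s IHs]; first by rewrite !big_nil.
rewrite !big_cons => x [a Fa [b sb <-]]; exists a; first exact: FF.
by exists b => //; exact: IHs.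
Qed.

Lemma prods_subgroup s F : (forall h, h \in s -> subgroup (F h)) ->
  (forall h k, h \in s -> k \in s -> normalises (F h) (F k)) ->
  subgroup (prods s F) /\ forall h, h \in s -> F h `<=` prods s F.
Proof.
elim: s => [|h s IHs] sF nF; first by rewrite big_nil; split=> //; exact: subgroup1.
have [|g g' gs gs'|sP FP] := IHs.
- by move=> g gs; apply: sF; rewrite inE gs orbT.
- by apply: nF; rewrite inE (gs, gs') orbT.
have [F1 _ _] := sF h (mem_head _ _); have [P1 _ _] := sP.
rewrite big_cons; split.
  apply: subgroup_mulset => //; first exact: sF (mem_head _ _).
  move=> u x Pu Fx; apply/conj_normaliserE => //.
  apply: (prods_min (subgroup_normaliser (F h)) _ Pu) => g gs.
  apply/normalises_normaliser; first by apply: sF; rewrite inE gs orbT.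
  by apply: nF; rewrite ?mem_head // inE gs orbT.
move=> g; rewrite inE => /predU1P[->|gs] x Fx.
  by exists x => //; exists 1; rewrite ?mulg1.
by exists 1 => //; exists x; [exact: FP gs _ Fx|rewrite mul1g].
Qed.

(** A representative [b] for the tail of the product is moved to the front by [y * b = b * y ^ b];
    then [y ^ b] runs through another conjugate of [M], again covered by [M]. *)
Lemma covered_prods s (f : I -> G) M : subgroup M -> commensurated M ->
  covered (prods s (fun i => conjset (f i) M)) M.
Proof.
move=> sM cM; have [M1 MM _] := sM.
have cMg g : covered (conjset g M) M.
  by have /(commensurableE (subgroup_conj g sM) sM)[] := cM g.
elim: s => [|h s [t tP]].
  rewrite big_nil; exists [:: 1] => x ->; exists 1; rewrite ?mem_head //.
  by rewrite mulVg.
have /choice[r rP] : forall b, exists r : seq G,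
    forall x, conjset (b^-1 * f h) M x -> exists2 g, g \in r & M (g^-1 * x).
  by move=> b; exact: cMg.
rewrite big_cons; exists [seq b * c | b <- t, c <- r b] => _ [y My [a Pa <-]].
have [b bt Mb] := tP a Pa; have [|c cr Mc] := rP b (y ^ b).
  by apply/conjsetE; rewrite -conjgM mulVKg; exact/conjsetE.
exists (b * c); first by apply/allpairsPdep; exists b, c.
by have := MM _ _ Mc Mb; rewrite conjgE !gnorm.
Qed.

End BigProducts.

Lemma compact_prods (G : topologicalGroupType) (I : eqType) (s : seq I)
    (F : I -> set G) : (forall i, compact (F i)) ->
  compact (\big[@mulset G/[set 1]]_(i <- s) F i).
Proof.
move=> cF; elim: s => [|h s IHs]; first by rewrite big_nil; exact: compact_set1.
by rewrite big_cons; exact: compact_mulset.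
Qed.

Section Conjugates.
Variable G : topologicalGroupType.
Hypothesis hG : class_S G.
Implicit Types (A B H K L M N U V W : set G) (g x y n u : G) (s t : seq G).

Local Notation prods s F := (\big[@mulset G/[set 1]]_(h <- s) F h).

(** The substitute for [near_normaliser] when [K] is not commensurated. The list [s] is chosen
    before [V]: the same conjugates serve for factors as small as desired. *)
Definition conjugates_normaliser K : set G := [set n | exists s, forall V,
  nbhs (1 : G) V -> exists2 O, nbhs (1 : G) O &
    forall x, O x -> prods s (fun h => conjset h K `&` V) (x^-1 * x ^ n)].

(** Conjugation by [g] translates the list of conjugates and inversion reverses it, so products,
    inverses and conjugates of elements get lists by concatenation, reversal and translation. *)
Lemma normal_conjugates_normaliser K : subgroup K ->
  normal_subgroup (conjugates_normaliser K).
Proof.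
move=> sK.
have KJ g V h a : (conjset h K `&` [set v | V (v ^ g)]) a ->
    (conjset (g^-1 * h) K `&` V) (a ^ g).
  move=> [/conjsetE Ka Va]; split=> //.
  by apply/conjsetE; rewrite -conjgM mulVKg.
apply/normal_subgroupP; split; first split.
- exists [::] => V _; exists setT; first exact: filterT.
  by move=> x _; rewrite big_nil conjg1 mulVg.
- move=> n m [s sP] [t tP]; exists (t ++ [seq m^-1 * h | h <- s]) => V nV.
  have [O nO Os] := sP _ (nbhs1_conj m nV); have [O' nO' Ot] := tP V nV.
  exists (O `&` O'); first exact: filterI.
  move=> x [/Os Px /Ot Py].
  rewrite (_ : _ * _ = (x^-1 * x ^ m) * (x^-1 * x ^ n) ^ m); last first.
    by rewrite !conjgE !gnorm.
  by apply: prods_cat => //; apply: prodsJ Px; exact: KJ.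
- move=> n [s sP]; exists (rev s) => V nV.
  have nV' : nbhs (1 : G) [set x | V x^-1] by apply: nbhs_inv; rewrite invg1.
  have [O nO Os] := sP _ nV'; exists [set x | O (x ^ n^-1)].
    exact: nbhs1_conj.
  move=> x /Os Px; rewrite (_ : _ * _ = ((x ^ n^-1)^-1 * (x ^ n^-1) ^ n)^-1).
    apply: prodsV Px => h a [/conjsetE Ka Va]; split=> //; apply/conjsetE.
    by rewrite conjVg; case: sK => _ _; apply.
  by rewrite conjgKV invgM invgK.
- move=> g n _ [s sP]; exists [seq g^-1 * h | h <- s] => V nV.
  have [O nO Os] := sP _ (nbhs1_conj g nV); exists [set x | O (x ^ g^-1)].
    exact: nbhs1_conj.
  move=> x /Os Px; rewrite conjg_conj -{1}(conjgKV g x) -conjVg -conjMg.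
  by apply: prodsJ Px; exact: KJ.
Qed.

Lemma sub_conjugates_normaliser K : subgroup K -> open (normaliser K) ->
  K `<=` conjugates_normaliser K.
Proof.
move=> sK oK k Kk; exists [:: 1] => V nV.
exists (normaliser K `&` [set x | V (x^-1 * x ^ k)]).
  apply: filterI; last exact: nbhs_commg.
  by apply: open_nbhs1 => //; exact: subgroup_normaliser.
move=> x [Kx Vx]; apply: prods1; split=> //; rewrite conjset1.
rewrite -commgEl commgEr; case: sK => _ KM KV.
by apply: KM => //; apply/conj_normaliserE => //; exact: KV.
Qed.

(** Every conjugate of [K] has an open normaliser, hence finitely many conjugates under the compact
    group [U]. *)
Lemma invariant_representatives U K s : cosubgroup U -> open (normaliser K) ->
  exists t, (forall h, h \in s -> exists2 h', h' \in t & conjset h K = conjset h' K) /\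
    forall u h, U u -> h \in t -> exists2 h', h' \in t & conjset (u * h) K = conjset h' K.
Proof.
move=> [sU cU oU] oK; have [U1 UM _] := sU.
have /choice[r rP] : forall h, exists r : seq G, (forall u, u \in r -> U u) /\
    forall u, U u -> exists2 v, v \in r & normaliser (conjset h K) (v^-1 * u).
  move=> h; apply: covered_rep; first exact: subgroup_normaliser.
  apply: compact_covered => //; first exact: subgroup_normaliser.
  by rewrite normaliser_conj; exact: open_conjset.
have rE h u : U u -> exists2 v, v \in r h & conjset (u * h) K = conjset (v * h) K.
  move=> /(rP h).2[v vr Nvu]; exists v => //.
  by rewrite !conjsetM -{1}(mulVKg v u) conjsetM Nvu.
exists [seq v * h | h <- s, v <- r h]; split=> [h hs|u g Uu].
  have [v vr e] := rE h 1 U1; rewrite mul1g in e.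
  by exists (v * h) => //; apply/allpairsPdep; exists h, v.
move=> /allpairsPdep[h [v [hs vr ->]]]; rewrite mulgA.
have [v' v'r ->] := rE h (u * v) (UM _ _ Uu ((rP h).1 v vr)).
by exists (v' * h) => //; apply/allpairsPdep; exists h, v'.
Qed.

(* A finite product of small subgroups of conjugates of [K] can be taken so
   large that it is commensurated. *)
Lemma commensurated_product K : locally_normal K -> K <> [set 1] ->
  exists s L, [/\ locally_normal L, commensurated L, L <> [set 1] &
    L `<=` prods s (fun h => conjset h K)].
Proof.
move=> lnK K1; have [sK cK oK] := lnK.
have [U cU _] := small_cosubgroup hG filterT; have [sU cpU oU] := cU.
have [D [DV gD]] := exists_generators hG cU.
pose Q := conjugates_normaliser K.
have nQ : normal_subgroup Q by exact: normal_conjugates_normaliser.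
have Q1 : Q <> [set 1].
  move=> Q1; apply: K1; apply/seteqP; split=> [x|x ->]; last by case: sK.
  by move=> /(sub_conjugates_normaliser sK oK); rewrite -/Q Q1.
have /choice[f fP] : forall d, exists n, Q n /\ U (n^-1 * d).
  by move=> d; have [n Qn Un] := normal_dense hG d nQ Q1 sU oU; exists n.
have /choice[r rP] : forall d, exists r, forall V, nbhs (1 : G) V ->
    exists2 O, nbhs (1 : G) O & forall x, O x ->
    prods r (fun h => conjset h K `&` V) (x^-1 * x ^ f d).
  by move=> d; have [[t tP] _] := fP d; exists t.
(* The entry 1 puts the part of [K] in [W] into [L], which makes [L] nontrivial; the lists [r d] let
   [L] absorb the commutators with [f d]; invariance under [U] makes [U] normalise [L]. *)
have [s [rs sU']] := invariant_representatives (1 :: flatten [seq r d | d <- D]) cU oK.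
have nB : nbhs (1 : G) [set x | forall h, h \in s -> normaliser (conjset h K) x].
  apply: nbhs_seq => h _; apply: open_nbhs1; first exact: subgroup_normaliser.
  by rewrite normaliser_conj; exact: open_conjset.
(* [W] normalises every conjugate in the list, so the factors [A h] normalise one another and their
   product is a subgroup. *)
have [W [cW WN WU nW]] := core_cosubgroup hG cU nB; have [sW cpW oW] := cW.
pose A h := conjset h K `&` W; pose L := prods s A.
have sA h : subgroup (A h) by apply: subgroupI => //; exact: subgroup_conj.
have [sL AL] : subgroup L /\ forall h, h \in s -> A h `<=` L.
  apply: prods_subgroup => // h g _ gs u x [_ Wu] [Kx Wx]; split.
    by apply/conj_normaliserE => //; exact: WN Wu _ gs.
  exact: normalises_refl.
have rL h : h \in 1 :: flatten [seq r d | d <- D] -> A h `<=` L.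
  by move=> /rs[h' h's e]; rewrite /A e; exact: AL.
have UL : normalises U L.
  move=> u x Uu; suff : L `<=` conjset u L by move=> LL /LL/conjsetE.
  apply: prods_min => [|h hs y [/conjsetE Ky Wy]]; first exact: subgroup_conj.
  apply/conjsetE; have UuV : U u^-1 by case: sU => _ _; apply.
  have [h' h's e] := sU' _ h UuV hs; apply: (AL h' h's); split; last exact: nW.
  by rewrite -e; apply/conjsetE; rewrite -conjgM mulVKg.
have cL : compact L.
  apply: compact_prods => h; rewrite /A setIC; apply: compact_closedI => //.
  by apply: (closedS hG); exact: compact_conjset.
have oL : open (normaliser L).
  apply: (open_subgroupS sU) => //; first exact: subgroup_normaliser.
  exact/normalises_normaliser.
have LD d : d \in D -> covered L (conjset d L).
  move=> dD; have [O nO Or] := rP d W (open_nbhs1 sW oW).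
  have [V [sV cV oV] VO] := small_cosubgroup hG nO.
  apply: coveredSr (covered_setI sL sV (compact_covered cL sV oV)).
  move=> x [Lx /VO/Or Px]; apply/conjsetE.
  rewrite -(mulVKg (f d) d) conjgM; apply: UL; first by case: (fP d).
  rewrite -(mulVKg x (x ^ f d)); have [_ LM _] := sL; apply: LM => //.
  apply: prods_min Px => // h hr; apply: rL; rewrite inE; apply/orP; right.
  by apply/flatten_mapP; exists d.
exists s, L; split=> //.
- suff : commensurator L = setT by move=> e g; have : commensurator L g by rewrite e.
  apply: gD; first exact: subgroup_commensurator.
    apply: subset_trans (normaliser_commensurator sL).
    exact/normalises_normaliser.
  move=> d dD; apply/(commensurableE (subgroup_conj d sL) sL); split; last exact: LD.
  by have := covered_conj d (LD _ (DV d dD)); rewrite -conjsetM mulgV conjset1.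
- move=> L1; apply: K1; apply: (finite_locally_normal hG lnK).
  apply: covered1_finite; rewrite -L1; apply: coveredSr (rL 1 (mem_head _ _)) _.
  rewrite /A conjset1; apply: covered_setI => //; exact: compact_covered.
- by apply: prodsS => h x [].
Qed.

End Conjugates.

(** * Baire category *)

Section Baire.
Variable G : topologicalGroupType.
Hypothesis hG : class_S G.
Implicit Types (A B H K L M N U V W : set G) (g x y u : G).

(** Otherwise one builds decreasing cosets of compact open subgroups, the successive ones avoiding
    [A 0], [A 1] and so on; a common point contradicts the covering. *)
Lemma baire_cosubgroup U (A : nat -> set G) : cosubgroup U ->
  (forall n, closed (A n)) -> U `<=` \bigcup_n A n ->
  exists n u V, cosubgroup V /\ lcoset u V `<=` A n.
Proof.
move=> cU cA UA; apply: contrapT => nAV.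
have step (p : nat * (G * set G)) : exists q : G * set G, cosubgroup p.2.2 ->
    [/\ cosubgroup q.2, lcoset q.1 q.2 `<=` lcoset p.2.1 p.2.2 &
      lcoset q.1 q.2 `<=` ~` A p.1].
  case: p => n [u V] /=; have [cV|nV] := pselect (cosubgroup V); last by exists (u, V).
  have [x uVx nAx] : exists2 x, lcoset u V x & ~ A n x.
    apply: contrapT => h; apply: nAV; exists n, u, V; split=> // x uVx.
    by apply: contrapT => nAx; apply: h; exists x.
  have [sV _ oV] := cV.
  have nB : nbhs (1 : G) (V `&` [set v | (~` A n) (x * v)]).
    apply: filterI; first exact: open_nbhs1.
    apply: (@nbhs_lmul G x 1); rewrite mulg1; apply: open_nbhs_nbhs; split=> //.
    exact: closed_openC.
  have [V' cV' V'B] := small_cosubgroup hG nB.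
  exists (x, V') => _; split=> //= y.
    move=> /lcosetE/V'B[Vy _]; apply/lcosetE; move/lcosetE: uVx => Vx.
    by have [_ VM _] := sV; have := VM _ _ Vx Vy; rewrite mulgA mulgK.
  by move=> /lcosetE/V'B[_ /=]; rewrite mulVKg.
have [h hP] := choice step.
pose p := fix p n := if n is n'.+1 then h (n', p n') else (1, U).
have cp n : cosubgroup (p n).2.
  by elim: n => //= n IHn; have [] := hP (n, p n) IHn.
pose F n := lcoset (p n).1 (p n).2.
have FS n : F n.+1 `<=` F n by have [] := hP (n, p n) (cp n).
have Fle m n : (m <= n)%N -> F n `<=` F m.
  move=> /subnK <-; elim: (n - m)%N => [|k IHk] //.
  by rewrite addSn => x /FS/IHk.
have [sU cpU oU] := cU.
have F0 : F 0%N = U.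
  by apply/seteqP; split=> x; [move=> /lcosetE|move=> Ux; apply/lcosetE]; rewrite invg1 mul1g.
have [|n _|m n _ _|n _|x Ux Fx] := @compact_directed _ U nat setT F cpU.
- by exists 0%N.
- by apply: closed_lcoset; case: (cp n) => *; exact: (closedS hG).
- exists (maxn m n) => // x Fx.
  by split; apply: Fle Fx; rewrite ?leq_maxl ?leq_maxr.
- have Fn : F n (p n).1 by apply/lcosetE; rewrite mulVg; case: (cp n) => -[].
  by exists (p n).1; split=> //; rewrite -F0; exact: (Fle 0%N n).
have [n _ Anx] := UA x Ux.
by have [_ _ /(_ x)] := hP (n, p n) (cp n); apply=> //; exact: (Fx n.+1).
Qed.

(** Choose decreasing subgroups, each carried by every [d] in [D] into the previous one and, after
    the first, normalised by [U]. Their intersection is a closed normal subgroup of [G] inside [U],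
    hence trivial, and compactness makes them a base at 1. *)
Lemma countable_base : exists V : nat -> set G, (forall n, cosubgroup (V n)) /\
  forall B, nbhs (1 : G) B -> exists n, V n `<=` B.
Proof.
have [U cU _] := small_cosubgroup hG filterT; have [sU cpU oU] := cU.
have [D [DV gD]] := exists_generators hG cU.
have step V : exists V', cosubgroup V -> [/\ cosubgroup V',
    V' `<=` V, forall d, d \in D -> V' `<=` [set x | V (x ^ d)], V' `<=` U & normalises U V'].
  have [[sV cV oV]|nV] := pselect (cosubgroup V); last by exists V.
  have nB : nbhs (1 : G) (V `&` [set x | forall d, d \in D -> V (x ^ d)]).
    apply: filterI; first exact: open_nbhs1.
    by apply: nbhs_seq => d _; apply: nbhs1_conj; exact: open_nbhs1.
  have [V' [cV' V'B V'U nV']] := core_cosubgroup hG cU nB.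
  exists V' => _; split=> //; first by move=> x /V'B[].
  by move=> d dD x /V'B[_]; apply.
have [h hP] := choice step.
pose V n := iter n h U.
have cV n : cosubgroup (V n).
  by elim: n => //= n IHn; have [] := hP _ IHn.
have VS n : V n.+1 `<=` V n by have [] := hP _ (cV n).
have Vle m n : (m <= n)%N -> V n `<=` V m.
  move=> /subnK <-; elim: (n - m)%N => [|k IHk] //.
  by rewrite addSn => x /VS/IHk.
pose R := \bigcap_n V n.
have sR : subgroup R by apply: subgroup_bigcap => n _; case: (cV n).
have R1 : R = [set 1].
  apply: (closed_normal_trivial hG cU) => //.
  - by apply: closed_bigI => n _; case: (cV n) => *; exact: (closedS hG).
  - by move=> x /(_ 0%N I).
  have RD d x : d \in D -> R x -> R (x ^ d).
    move=> dD Rx n _; have [_ _ /(_ d dD)] := hP _ (cV n).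
    by move=> /(_ x) + _ _; apply; exact: (Rx n.+1).
  apply: gD; first exact: subgroup_normaliser.
    apply/normalises_normaliser => // u x Uu Rx n _; apply: VS.
    have [_ _ _ _ nV] := hP _ (cV n); apply: nV => //; exact: (Rx n.+1).
  move=> d dD; apply/seteqP; split=> x; last by move=> Rx; apply/conjsetE; exact: RD.
  by move=> /conjsetE Rx; rewrite -(conjgK d x); apply: RD => //; exact: DV.
exists V; split=> // B nB; apply: contrapT => nVB.
have [|n _|m n _ _|n _|x Ux Fx] :=
  @compact_directed _ U nat setT (fun n => V n `&` ~` B°) cpU.
- by exists 0%N.
- apply: closedI; first by case: (cV n) => *; exact: (closedS hG).
  by apply: open_closedC; exact: open_interior.
- exists (maxn m n) => // x [Vx nBx].
  by split; split=> //; apply: Vle Vx; rewrite ?leq_maxl ?leq_maxr.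
- apply: contrapT => e; apply: nVB; exists n => x Vx; apply: contrapT => nBx.
  apply: e; exists x; split; first exact: (Vle 0%N n).
  by split=> // /interior_subset.
have : R x by move=> n _; case: (Fx n I).
rewrite R1 => x1; have [_] := Fx 0%N I; apply.
by rewrite x1.
Qed.

(* Baire makes the commensuration uniform over a coset of an open subgroup. *)
Lemma commensurated_locally_normal K : subgroup K -> compact K -> commensurated K ->
  exists M, [/\ locally_normal M, commensurated M, covered K M & M `<=` K].
Proof.
move=> sK cpK cK; have clK := closedS hG cpK.
have [U cU _] := small_cosubgroup hG filterT; have [sU cpU oU] := cU.
have [V [cV VB]] := countable_base.
pose A n := [set u : G | forall x, K x -> V n x -> K (x ^ u)].
have clA n : closed (A n).
  rewrite (_ : A n = \bigcap_(x in K `&` V n) [set u | K (x ^ u)]).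
    apply: closed_bigI => x _; rewrite -openC openE => u nKu.
    have : nbhs (x ^ u) (~` K) by apply: open_nbhs_nbhs; split=> //; exact: closed_openC.
    rewrite conjgE => /nbhs_mul[B [B' [/nbhs_inv nB /nbhs_lmul nB' BB']]].
    apply: filterS (filterI nB nB') => v [Bv B'v].
    by have := BB' _ _ Bv B'v; rewrite -conjgE.
  apply/seteqP; split=> u Au x; first by move=> [Kx Vx]; exact: Au.
  by move=> Kx Vx; apply: (Au x).
have [|n [u [O [[sO cO oO] OA]]]] := @baire_cosubgroup U A cU clA.
  move=> u _; have [B nB BK] := commensurated_nbhs u sK clK cK.
  by have [n VnB] := VB B nB; exists n => // x Kx /VnB; exact: BK.
(* [O] normalises this core, so its normaliser is open. If [y] is in [K] and in [V n], then
   [y ^ (u * v)] is in [K] for all [v] in [O], so [y ^ u] lies in the core; this gives finite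
   index. *)
pose M := core O K; have sM : subgroup M by exact: subgroup_core.
have MK : M `<=` K by exact: core_sub.
have [sV _ oV] := cV n.
have KM : covered K M.
  have /(commensurableE (subgroup_conj u^-1 sK) sK)[_ c] := cK u^-1.
  apply: (covered_trans c).
  have := covered_conj u^-1 (covered_setI sK sV (compact_covered cpK sV oV)).
  apply: coveredSr => x /conjsetE[Kx Vx] v Ov.
  have : A n (u * v) by apply: OA; apply/lcosetE; rewrite mulKg.
  by move=> /(_ _ Kx Vx); rewrite -conjgM mulKg.
exists M; split=> //; last exact: commensuratedS (coveredS MK (covered_refl K)) KM cK.
split=> //; first by apply: (subclosed_compact _ cpK MK); exact: closed_core.
apply: (open_subgroupS sO) => //; first exact: subgroup_normaliser.
by apply/normalises_normaliser => //; exact: normalises_core.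
Qed.

(** Each double coset [UdU] is a finite union of cosets [v * d * U], so products of the finitely
    many letters [v * d] meet all cosets of [U]. Words are lists of indices, which makes the
    transversal countable. *)
Lemma countable_transversal U : cosubgroup U ->
  exists h : seq nat -> G, forall g, exists w, U ((h w)^-1 * g).
Proof.
move=> cU; have [sU cpU oU] := cU; have [U1 UM UV] := sU.
have [D [DV gD]] := exists_generators hG cU.
have /choice[t tP] : forall d, exists t : seq G, (forall u, u \in t -> U u) /\
    forall u, U u -> exists2 v, v \in t & conjset d U (v^-1 * u).
  move=> d; apply: covered_rep; first exact: subgroup_conj.
  by apply: compact_covered => //; [exact: subgroup_conj|exact: open_conjset].
pose E := [seq v * d | d <- D, v <- t d].
have UD u d : U u -> d \in D -> exists j, U ((nth 1 E j)^-1 * (u * d)).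
  move=> Uu dD; have [v vt /conjsetE Uvu] := (tP d).2 u Uu.
  exists (index (v * d) E); rewrite nth_index; last by apply/allpairsPdep; exists d, v.
  by move: Uvu; rewrite conjgE invgM !mulgA.
pose h := fix h (w : seq nat) := if w is i :: w' then nth 1 E i * h w' else 1.
pose T := [set g | exists w, U ((h w)^-1 * g)].
have TU u g : U u -> T g -> T (u * g).
  move=> + [w]; elim: w u g => [|i w IHw] u g Uu /=.
    by rewrite invg1 mul1g => Ug; exists [::]; rewrite /= invg1 mul1g; exact: UM.
  rewrite invgM -mulgA => Ug.
  have [lt_i|le_i] := ltnP i (size E); last first.
    by have := IHw _ _ Uu Ug; rewrite nth_default // invg1 mul1g.
  have /allpairsPdep[d [v [dD vt e]]] := mem_nth 1 lt_i.
  have [j Uj] := UD _ _ (UM _ _ Uu ((tP d).1 v vt)) dD.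
  have [w' Uw'] := IHw _ _ Uj Ug; exists (j :: w') => /=.
  by move: Uw'; rewrite e; congr U; rewrite !gnorm.
have TD d g : d \in D -> T g -> T (d * g).
  move=> dD Tg; have [j] := UD _ _ U1 dD; rewrite mul1g => Uj.
  have [w Uw] := TU _ _ Uj Tg; exists (j :: w) => /=.
  by move: Uw; congr U; rewrite !gnorm.
pose S := [set g | forall x, T x -> T (g * x) /\ T (g^-1 * x)].
have ST : S = setT.
  apply: gD => [|u Uu x Tx|d dD x Tx].
  - split=> [x|g g' Sg Sg' x Tx|g Sg x /Sg[]]; first by rewrite invg1 mul1g.
      rewrite invgM -!mulgA; split; first by case: (Sg' x Tx) => /Sg[].
      by case: (Sg x Tx) => _ /Sg'[].
    by rewrite invgK.
  - by split; apply: TU => //; exact: UV.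
  - by split; apply: TD => //; exact: DV.
exists h => g; have : S g by rewrite ST.
have T1 : T 1 by exists [::]; rewrite /= invg1 mul1g.
by move=> /(_ 1 T1)[]; rewrite mulg1.
Qed.

(** The abstract normal closure of [M] is a countable union of compact products of conjugates, and
    it equals [G]. By Baire one product contains a coset of an open subgroup, and [covered_prods]
    covers that product by [M]. *)
Lemma abstractly_simple_open U M : abstractly_simple G -> cosubgroup U ->
  locally_normal M -> commensurated M -> U `<=` normaliser M -> M <> [set 1] ->
  covered U M.
Proof.
move=> asG cU [sM cpM oM] cM UM M1.
have [h hP] := countable_transversal cU.
pose P (s : seq (seq nat)) := \big[@mulset G/[set 1]]_(w <- s) conjset (h w) M.
pose N := [set g | exists s, P s g].
have hM g : exists w, conjset g M = conjset (h w) M.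
  have [w Uw] := hP g; exists w.
  by rewrite -{1}(mulVKg (h w) g) conjsetM (UM _ Uw).
have /choice[f fP] : forall p : G * seq nat, exists w,
    conjset (p.1 * h p.2) M = conjset (h w) M by move=> p; exact: hM.
have PJ g s x : P s x -> P [seq f (g^-1, w) | w <- s] (x ^ g).
  apply: prodsJ => w a /conjsetE Ma; rewrite -fP /=; apply/conjsetE.
  by rewrite -conjgM mulVKg.
have nN : normal_subgroup N.
  apply/normal_subgroupP; split; first split.
  - by exists [::]; rewrite /P big_nil.
  - by move=> x y [s Px] [t Py]; exists (s ++ t); exact: prods_cat.
  - move=> x [s Px]; exists (rev s); apply: prodsV Px => w a.
    by move=> /conjsetE Ma; apply/conjsetE; rewrite conjVg; case: sM => _ _; apply.
  - by move=> g x _ [s Px]; exists [seq f (g^-1, w) | w <- s]; exact: PJ.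
have MN : M `<=` N.
  move=> x Mx; have [w e] := hM 1; exists [:: w]; apply: prods1.
  by rewrite -e conjset1.
have NT : N = setT.
  have [N1|//] := asG N nN; case: M1; apply/seteqP; split=> x; first by move/MN; rewrite N1.
  by move=> ->; case: sM.
(* The products are enumerated through the codes of their index lists; a number that codes no list
   gets the empty set. *)
pose A n := if unpickle n is Some s then P s else set0.
have [n|x _|n [u [V [cV VA]]]] := @baire_cosubgroup U A cU.
- rewrite /A; case: (unpickle n) => [s|]; last exact: closed0.
  by apply: (closedS hG); apply: compact_prods => w; exact: compact_conjset.
- have [s Ps] : N x by rewrite NT.
  by exists (pickle s) => //; rewrite /A pickleK.
have [sV _ oV] := cV; have [_ cpU _] := cU.
apply: covered_trans (compact_covered cpU sV oV) _.
have : covered (lcoset u V) M.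
  apply: (coveredS VA); rewrite /A; case: (unpickle n) => [s|].
    exact: covered_prods.
  by exists [::] => y [].
move=> /(covered_lcoset u^-1); apply: coveredS => v Vv.
by exists (u * v); [exists v|rewrite mulKg].
Qed.

End Baire.

(** * The class of compact open subgroups, and the four assertions *)

Lemma cosubgroup_locally_normal (G : topologicalGroupType) (U : set G) :
  cosubgroup U -> locally_normal U.
Proof.
move=> [sU cU oU]; split=> //.
apply: (open_subgroupS sU) => //; first exact: subgroup_normaliser.
by apply/normalises_normaliser => //; exact: normalises_refl.
Qed.

Lemma LNclass_infty (G : topologicalGroupType) (U M : set G) (lnM : locally_normal M) :
  cosubgroup U -> LNclass (LNSub lnM) = LN_infty <-> covered U M.
Proof.
move=> cU; have [sU cpU oU] := cU; have [sM cM _] := lnM.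
rewrite (LN_inftyE (U := LNSub (cosubgroup_locally_normal cU)) oU) LNclass_eq.
rewrite /lnsub_set /= commensurableE //.
by split=> [[]//|c]; split=> //; exact: compact_covered.
Qed.

Lemma open_of_covered (G : topologicalGroupType) (U M : set G) :
  cosubgroup U -> subgroup M -> closed M -> covered U M -> open M.
Proof.
move=> [sU _ oU] sM cM UM; apply: nbhs_subgroup_open => //.
have [V nV VM] := closed_covered_nbhs sU sM cM UM.
by apply: filterS (filterI (open_nbhs1 sU oU) nV).
Qed.

Unset Implicit Arguments.

Theorem theorem2 (G : topologicalGroupType) (hG : class_S G) :
  exists mu : LN G,
    [/\ (* (i) *)
        unique (fun nu : LN G =>
          LNfixed G `\ LN0 = [set alpha : LN G | (nu <= alpha)%O]) mu,
        (* (ii) *)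
        mu = LN_infty <->
          (forall K : set G, locally_normal K -> K <> [set 1] ->
             exists s : seq G,
               nbhs (1 : G) (\big[@mulset G/[set 1]]_(g <- s) conjset g K)),
        (* (iii) *)
        mu = LN_infty ->
          forall K : set G, subgroup K -> compact K -> commensurated K ->
            finite_set K \/ open K
      & (* (iv) *)
        abstractly_simple G -> mu = LN_infty].
Proof.
have [U cU _] := small_cosubgroup hG filterT; have [sU cpU oU] := cU.
have [M [aM M1 Mmin]] := exists_least_commensurated hG cU.
have lnM := admissible_locally_normal cU aM.
have [sM clM _ nM cM] := aM; have [_ cpM _] := lnM.
pose mu := LNclass (LNSub lnM).
have fixedE : LNfixed G `\ LN0 = [set alpha : LN G | (mu <= alpha)%O].
  apply/seteqP; split=> a; have [K [lnK ->]] := LNclassP a.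
    move=> [/LNclass_fixed cK K0]; apply/LNclass_le; apply: Mmin => // K1.
    by apply: K0; exact/(LNclass0 hG).
  move=> /LNclass_le MK; split.
    exact/LNclass_fixed/(commensurated_above hG lnM lnK cM M1 MK).
  move=> /(LNclass0 hG) K1; apply: M1; apply: (finite_locally_normal hG lnM).
  by apply: covered1_finite; rewrite -K1.
(* If [mu] is the top class, finitely many cosets of [M] cover [U], and [M] is covered by every
   nontrivial commensurated locally normal subgroup. *)
have above K : locally_normal K -> commensurated K -> K <> [set 1] ->
    mu = LN_infty -> covered U K.
  by move=> lnK cK K1 /(LNclass_infty lnM cU) UM; exact: covered_trans UM (Mmin _ lnK cK K1).
exists mu; split.
(* An element of a poset is determined by the set of elements above it. *)
- split=> // nu nuE; have e : [set a : LN G | (mu <= a)%O] = [set a | (nu <= a)%O].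
    by rewrite -fixedE.
  apply/eqP; rewrite Order.POrderTheory.eq_le; apply/andP; split.
    have : [set a : LN G | (nu <= a)%O] nu by exact: Order.POrderTheory.lexx.
    by rewrite -e.
  have : [set a : LN G | (mu <= a)%O] mu by exact: Order.POrderTheory.lexx.
  by rewrite e.
- split=> [muE K lnK K1|/(_ M lnM M1)[s nP]].
    have [s [L [lnL cL L1 LK]]] := commensurated_product hG lnK K1.
    have [sL cpL _] := lnL; exists s; apply: filterS LK _.
    apply: open_nbhs1 => //; apply: (open_of_covered cU) => //.
      exact: (closedS hG).
    exact: above.
  (* Conversely, some product of conjugates of [M] contains an open subgroup; being commensurated,
     [M] covers that product, hence the open subgroup and [U]. *)
  apply/(LNclass_infty lnM cU).
  have [V [sV cV oV] VP] := small_cosubgroup hG nP.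
  apply: covered_trans (compact_covered cpU sV oV) _.
  apply: (coveredS VP); exact: covered_prods.
- move=> muE K sK cpK cK.
  have [L [lnL cL KL LK]] := commensurated_locally_normal hG sK cpK cK.
  have [sL cpL _] := lnL.
  have [L1|L1] := pselect (L = [set 1]).
    by left; apply: covered1_finite; rewrite -L1.
  right; apply: (open_subgroupS sL) => //.
  apply: (open_of_covered cU) => //; first exact: (closedS hG).
  exact: above.
- move=> asG; apply/(LNclass_infty lnM cU).
  apply: (abstractly_simple_open hG) => //.
  exact/normalises_normaliser.
Qed.
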